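(* Let $X=\{(x,y)\in\mathbb{C}^2\mid xy=0\}$ and let $\pi:(\mathcal{X},0)\to(\mathbb{C},0)$ be its semi-universal deformation, $\mathcal{X}=\{(x,y,s)\in\mathbb{C}^3\mid xy=s\}$, $\pi(x,y,s)=s$. Let $G$ be the non-reductive complex Lie group $(\mathbb{C}^*\times\mathbb{C}^* )\rtimes(\mathbb{C}\times\mathbb{C})$, acting locally holomorphically on the germ $(X,0)$ by $$\big((\lambda,\mu,a,b),(x,y)\big)\mapsto\left(\frac{\lambda x}{1-ax},\frac{\mu y}{1-by}\right).$$ Then this local $G$-action on $(X,0)$ cannot be extended to local $G$-actions on $(\mathcal{X},0)$ and on $(\mathbb{C},0)$ with respect to which the morphism $\pi$ is equivariant.
   Context: A local holomorphic $G$-action on a germ $(Y,0)$ is an action of group elements near the identity $1_G$ by holomorphic maps defined near $0$: for each pair $\pi=(U_\pi,V_\pi)$ of open neighbourhoods of $0$ in $Y$ with $U_\pi\Subset V_\pi$ there are an open neighbourhood $G_\pi$ of $1_G$ and a map $\Phi_\pi:G_\pi\to\mathrm{Hol}(U_\pi,V_\pi)$ such that $\Phi_\pi(1_G)=\mathrm{id}$; $\Phi_\pi(g)\circ\Phi_\pi(h)=\Phi_\pi(gh)$ wherever defined, for $g,h,gh\in G_\pi$; the maps for different pairs agree on overlaps; and $g\mapsto f\circ\Phi_\pi(g)$ is holomorphic for holomorphic functions $f$. The group structure on $G$ is the semidirect product for which the displayed formula is a local action; the action generates on $(X,0)$ the vector fields $v_1=x\partial_x$, $v_2=y\partial_y$,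 $v_3=x^2\partial_x$, $v_4=y^2\partial_y$, with $[v_1,v_3]=v_3$, $[v_2,v_4]=v_4$ and all other brackets $[v_i,v_j]$ ($i<j$) equal to zero. $(X,0)$ is identified with the central fibre $\pi^{-1}(0)$. *)

(* Defs.v *)
From HB Require Import structures.
From mathcomp Require Import all_boot all_order all_algebra.
From mathcomp Require Import complex ring.
From mathcomp Require Import all_classical all_reals all_analysis.

Set Implicit Arguments.
Unset Strict Implicit.
Unset Printing Implicit Defensive.

Import Order.TTheory GRing.Theory Num.Theory.
Import numFieldNormedType.Exports.

Local Open Scope classical_set_scope.
Local Open Scope ring_scope.

(* The field C of complex numbers over R, as a normed space over itself.      *)
(* C^n is a product of copies of it, and [differentiable] between normed      *)
(* spaces over R[i] is complex (Frechet) differentiability.                   *)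
Notation CC R := (R[i]^o)%type.

Section Holomorphic.
Variables (R : realType) (E F : normedModType R[i]).

(* U is a locally closed subset of E, typically a relatively open subset of a *)
(* (reduced) analytic set: a function on U is holomorphic if it is locally    *)
(* the restriction of a holomorphic function of the ambient space.  The       *)
(* values of f outside U are irrelevant.                                      *)
Definition holomorphic_on (U : set E) (f : E -> F) : Prop :=
  forall p, U p -> exists h : E -> F,
    (\forall q \near p, differentiable h q) /\
    (\forall q \near p, U q -> f q = h q).

End Holomorphic.

Section HolomorphicMaps.
Variables (R : realType) (E : normedModType R[i]).

(* Hol(U, V) *)
Definition Hol (U V : set E) : set (E -> E) :=
  [set f | holomorphic_on U f /\ forall p, U p -> V (f p)].

(* F : D -> O(U) is holomorphic, for D open in T and O(U) the Frechet space   *)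
(* of holomorphic functions on U with uniform convergence on compact sets:    *)
(* F is complex differentiable at each point of D, with differential L.       *)
(* T is to be finite-dimensional, so that L is automatically continuous.      *)
Definition holomorphic_family (T : normedModType R[i]) (D : set T) (U : set E)
    (F : T -> E -> CC R) : Prop :=
  forall t0, D t0 -> exists L : T -> E -> CC R,
    [/\ forall h, holomorphic_on U (L h),
        forall p, U p -> linear (fun h => L h p) &
        forall K : set E, compact K -> K `<=` U ->
        forall e : R[i], 0 < e ->
        \forall t \near t0, forall p, K p ->
          `|F t p - F t0 p - L (t - t0) p| <= e * `|t - t0|].

Definition open_nbhd_in (Y U : set E) : Prop :=
  U 0 /\ exists2 O : set E, open O & U = Y `&` O.

(* U is relatively compact in V.  A compact closure of U in Y contained in V  *)
(* is compact in E, hence is the closure of U in E.                           *)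
Definition rel_compact (U V : set E) : Prop :=
  compact (closure U) /\ closure U `<=` V.

Definition nbhd_pair (Y U V : set E) : Prop :=
  [/\ open_nbhd_in Y U, open_nbhd_in Y V & rel_compact U V].

End HolomorphicMaps.

(* ((lambda, mu), (a, b)) *)
Notation Gcoord R := ((CC R * CC R) * (CC R * CC R))%type.

Section Group.
Variable R : realType.

(* (C^* x C^* ) |x (C x C) as an open subset of C^4 *)
Definition Gset : set (Gcoord R) := [set g | g.1.1 != 0 /\ g.1.2 != 0].

Definition Gone : Gcoord R := ((1, 1), (0, 0)).

(* The law for which the formula [actX] below satisfies g (h q) = (gh) q.     *)
Definition Gmul (g h : Gcoord R) : Gcoord R :=
  ((g.1.1 * h.1.1, g.1.2 * h.1.2),
   (g.2.1 * h.1.1 + h.2.1, g.2.2 * h.1.2 + h.2.2)).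

Definition Ginv (g : Gcoord R) : Gcoord R :=
  ((g.1.1^-1, g.1.2^-1), (- g.2.1 / g.1.1, - g.2.2 / g.1.2)).

End Group.

Section LocalAction.
Variables (R : realType) (E : normedModType R[i]).

(* A local holomorphic action of the group on the germ (Y, 0).  Being an      *)
(* action on a germ, it is given on some representative Y `&` la_rep of it.   *)
(* la_dom U V is the neighbourhood G_(U, V) of the identity, and la_map U V   *)
(* is Phi_(U, V); its values outside la_dom U V and U are irrelevant.         *)
Record local_action (Y : set E) := LocalAction {
  la_rep : set E;
  la_dom : set E -> set E -> set (Gcoord R);
  la_map : set E -> set E -> Gcoord R -> E -> E;
  la_rep_open : open la_rep;
  la_rep0 : la_rep 0;
  la_dom_open : forall U V, nbhd_pair (Y `&` la_rep) U V ->
    [/\ open (la_dom U V), la_dom U V `<=` @Gset R & la_dom U V (Gone R)];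
  la_hol : forall U V, nbhd_pair (Y `&` la_rep) U V ->
    forall g, la_dom U V g -> Hol U V (la_map U V g);
  la_one : forall U V, nbhd_pair (Y `&` la_rep) U V ->
    forall p, U p -> la_map U V (Gone R) p = p;
  la_mul : forall U V, nbhd_pair (Y `&` la_rep) U V ->
    forall g h, la_dom U V g -> la_dom U V h -> la_dom U V (Gmul g h) ->
    forall p, U p -> U (la_map U V h p) ->
      la_map U V g (la_map U V h p) = la_map U V (Gmul g h) p;
  la_compat : forall U V U' V',
    nbhd_pair (Y `&` la_rep) U V -> nbhd_pair (Y `&` la_rep) U' V' ->
    forall g, la_dom U V g -> la_dom U' V' g ->
    forall p, U p -> U' p -> la_map U V g p = la_map U' V' g p;
  la_family : forall U V, nbhd_pair (Y `&` la_rep) U V ->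
    forall f : E -> CC R, holomorphic_on V f ->
    holomorphic_family (la_dom U V) U (fun g p => f (la_map U V g p))
}.

Definition la_pair (Y : set E) (A : local_action Y) : set E -> set E -> Prop :=
  nbhd_pair (Y `&` la_rep A).

End LocalAction.

(* phi : (Y, 0) -> (Z, 0) intertwines the local actions, as an identity       *)
(* between germs at (1_G, 0) of maps on G x Y.                                *)
Definition equivariant (R : realType) (E F : normedModType R[i])
    (Y : set E) (Z : set F) (A : local_action Y) (B : local_action Z)
    (phi : E -> F) : Prop :=
  forall U V S T, la_pair A U V -> la_pair B S T ->
  \forall g \near Gone R & p \near (0 : E),
    Y p -> phi (la_map A U V g p) = la_map B S T g (phi p).

Section Node.
Variable R : realType.

Definition nodeX : set (CC R * CC R)%type := [set q | q.1 * q.2 = 0].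

Definition actX (g : Gcoord R) (q : CC R * CC R) : CC R * CC R :=
  (g.1.1 * q.1 / (1 - g.2.1 * q.1), g.1.2 * q.2 / (1 - g.2.2 * q.2)).

(* points are ((x, y), s) *)
Definition totalX : set ((CC R * CC R) * CC R)%type :=
  [set p | p.1.1 * p.1.2 = p.2].

Definition defpi (p : (CC R * CC R) * CC R) : CC R := p.2.

Definition fibre0 (q : CC R * CC R) : (CC R * CC R) * CC R := (q, 0).

(* The local action A on (totalX, 0) restricts on the central fibre to the    *)
(* local action on (nodeX, 0) given by [actX].  The denominators of [actX]    *)
(* do not vanish for (g, q) near (1_G, 0).                                    *)
Definition extends_actX (A : local_action totalX) : Prop :=
  forall U V, la_pair A U V ->
  \forall g \near Gone R & q \near (0 : CC R * CC R),
    nodeX q -> la_map A U V g (fibre0 q) = fibre0 (actX g q).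

End Node.

Section Facts.
Variable R : realType.
Implicit Types (g h k : Gcoord R).

Lemma Gset1 : Gset (Gone R).
Proof. by split; rewrite /= oner_eq0. Qed.

Lemma GsetM g h : Gset g -> Gset h -> Gset (Gmul g h).
Proof. by move=> [g1 g2] [h1 h2]; split; rewrite /= mulf_neq0. Qed.

Lemma GsetV g : Gset g -> Gset (Ginv g).
Proof. by move=> [g1 g2]; split; rewrite /= invr_neq0. Qed.

Lemma GmulA g h k : Gmul g (Gmul h k) = Gmul (Gmul g h) k.
Proof. by congr ((_, _), (_, _)) => /=; ring. Qed.

Lemma Gmul1g g : Gmul (Gone R) g = g.
Proof.
by case: g => [[l m] [a b]]; rewrite /Gmul /= !mul1r !mul0r !add0r.
Qed.

Lemma Gmulg1 g : Gmul g (Gone R) = g.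
Proof. by case: g => [[l m] [a b]]; rewrite /Gmul /= !mulr1 !addr0. Qed.

Lemma GmulV g : Gset g -> Gmul g (Ginv g) = Gone R.
Proof.
case: g => [[l m] [a b]] [/= l0 m0]; rewrite /Gmul /Gone /=.
by rewrite !divff // !mulNr !subrr.
Qed.

Lemma actX1 q : actX (Gone R) q = q.
Proof. by case: q => x y; rewrite /actX /= !mul0r !subr0 !divr1 !mul1r. Qed.

Lemma actX_node g q : nodeX q -> nodeX (actX g q).
Proof.
by rewrite /nodeX /= => q0; rewrite mulrACA [X in X * _]mulrACA q0 mulr0 mul0r.
Qed.

Lemma actXM g h q :
  1 - h.2.1 * q.1 != 0 -> 1 - h.2.2 * q.2 != 0 ->
  1 - g.2.1 * (actX h q).1 != 0 -> 1 - g.2.2 * (actX h q).2 != 0 ->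
  actX g (actX h q) = actX (Gmul g h) q.
Proof.
have step (l a m b x : R[i]) : 1 - b * x != 0 ->
    1 - a * (m * x / (1 - b * x)) != 0 ->
    l * (m * x / (1 - b * x)) / (1 - a * (m * x / (1 - b * x))) =
    l * m * x / (1 - (a * m + b) * x).
  move=> u0 w0; have := mulf_neq0 w0 u0.
  have e : (1 - a * (m * x / (1 - b * x))) * (1 - b * x) =
           1 - (a * m + b) * x.
    by rewrite mulrBl -!mulrA [_^-1 * _]mulVf //; ring.
  rewrite e => v0; apply/eqP; rewrite eqr_div // -e; apply/eqP.
  by rewrite -!mulrA; congr (l * _); rewrite mulrCA; field.
by move=> u1 u2 w1 w2; congr pair; apply: step.
Qed.

Lemma fibre0E : @fibre0 R @` @nodeX R = @totalX R `&` (@defpi R) @^-1` [set 0].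
Proof.
apply/seteqP; split => [p [q q0 <-] //|[[x y] s] [/= xy s0]].
by exists (x, y); rewrite /nodeX /fibre0 /= ?xy -?s0.
Qed.

End Facts.

(* Main.v *)
From HB Require Import structures.
Require Import Defs.
From mathcomp Require Import all_boot all_order all_algebra.
From mathcomp Require Import complex ring lra.
From mathcomp Require Import all_classical all_reals all_analysis.

Set Implicit Arguments.
Unset Strict Implicit.
Unset Printing Implicit Defensive.

Import Order.TTheory GRing.Theory Num.Theory.
Import numFieldNormedType.Exports.

Local Open Scope classical_set_scope.
Local Open Scope ring_scope.

(** Near the origin the total space [xy = s] is a graph over the plane of [(x, y)],
    so an extended local action acts there by holomorphic maps of the plane that fix
    the origin.  Let [F = (F1, F2)] and [H = (H1, H2)] be the maps of the commuting
    group elements [((1, 1), (a, 0))] and [((1, 1), (0, b))], with [a] and [b] small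
    and nonzero.  On the two axes they are prescribed.  By equivariance [F1 * F2] and
    [H1 * H2] are functions of [xy], hence invariant under [(x, y) |-> (- x, - y)],
    so their cubic parts vanish.  This leaves, up to terms of order 3,
    [F = (x + a x^2, y - a x y)] and [H = (x - b x y, y + b y^2)]
    ([shear_like_bijet]).  But such maps do not commute: on the diagonal [(t, t)] the
    first components of the two compositions differ by [- 2 a b t^3] at order 3
    ([no_commuting_shears]).  Infinitesimally, with [E = x d/dx - y d/dy], the lifts
    of [x^2 d/dx] and [y^2 d/dy] begin with [x E] and [- y E], whose bracket is
    [2 x y E].

    The expansions have to be established for functions that are only assumed to be
    complex differentiable near the origin ([bijet_exists]).  This rests on a discrete
    form of Cauchy's theory.  Trapezoidal sums along the boundary of a square are
    exactly additive under subdivision into quarters and vanish on affine functions,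
    so that Goursat's bisection shows that they tend to 0 as the mesh is refined
    ([goursat]).  The error allowed to a square is proportional to an additive weight
    which, for the squares through a given point [w], is at least their side; this
    makes room for a function that is merely continuous at [w], such as a difference
    quotient, and gives Cauchy's formula ([cauchy_formula]).  Taylor coefficients are
    limits of discrete sums along an ultrafilter ([taylor_functional]).  As such they
    are bounded linear functionals of arbitrary bounded functions on the contour, and
    can be applied in one variable after the other ([taylor_bidisc]). *)

(** * Trapezoidal sums along the boundary of a square *)

Section Trapezoid.
Variable R : realType.
Local Notation C := (R[i]).
Local Notation ii := ('i%C : C).
Local Notation Re := (@complex.Re R).
Local Notation Im := (@complex.Im R).
Implicit Types (f g : C -> C) (p d h : C) (m n : nat).

(** Trapezoidal rule for the integral of [f] along the [m] consecutive steps [d]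
    that start at [p]. *)
Definition trap f p d m : C :=
  \sum_(k < m) (f (p + k%:R * d) + f (p + k.+1%:R * d)) * (d / 2).

Lemma trap_cat f p d m n :
  trap f p d (m + n) = trap f p d m + trap f (p + m%:R * d) d n.
Proof.
rewrite /trap big_split_ord /=; congr (_ + _); apply: eq_bigr => k _.
by rewrite -addnS !natrD !mulrDl !addrA.
Qed.

Lemma trap_rev f p d m : trap f (p + m%:R * d) (- d) m = - trap f p d m.
Proof.
rewrite /trap (reindex_inj rev_ord_inj) /= -sumrN; apply: eq_bigr => k _.
have km : (k.+1 <= m)%N := ltn_ord k.
have -> : p + m%:R * d + (m - k.+1)%:R * - d = p + k.+1%:R * d.
  by rewrite natrB //; ring.
have -> : p + m%:R * d + (m - k.+1).+1%:R * - d = p + k%:R * d.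
  by rewrite -subSn // subSS natrB ?(ltnW km) //; ring.
by rewrite mulNr mulrN addrC.
Qed.

Lemma trap_scale f (c : C) p d m :
  trap f (c * p) (c * d) m = c * trap (fun z => f (c * z)) p d m.
Proof.
rewrite /trap mulr_sumr; apply: eq_bigr => k _.
rewrite ![_%:R * (c * d)]mulrCA -!mulrDr; ring.
Qed.

Lemma trap_lin f g (c : C) p d m :
  trap (fun z => f z + c * g z) p d m = trap f p d m + c * trap g p d m.
Proof.
rewrite /trap mulr_sumr -big_split /=; apply: eq_bigr => k _; ring.
Qed.

Lemma trap_affine (a b : C) p d m :
  trap (fun z => a + b * z) p d m =
  (fun z => a * z + b * z ^+ 2 / 2) (p + m%:R * d) -
  (fun z => a * z + b * z ^+ 2 / 2) p.
Proof.
rewrite /trap; elim: m => [|m IH] /=; first by rewrite big_ord0 mul0r addr0 subrr.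
rewrite big_ord_recr /= IH -natr1; by field.
Qed.

Lemma trap_le f p d m (M : C) :
  (forall k, (k <= m)%N -> `|f (p + k%:R * d)| <= M) ->
  `|trap f p d m| <= M * (m%:R * `|d|).
Proof.
move=> fM; rewrite /trap (le_trans (ler_norm_sum _ _ _)) //.
have -> : M * (m%:R * `|d|) = \sum_(k < m) ((M + M) * (`|d| / 2)).
  by rewrite sumr_const card_ord -[RHS]mulr_natl; field.
apply: ler_sum => k _.
rewrite normrM normrM normfV (@ger0_norm _ 2) ?ler0n //.
rewrite ler_wpM2r ?divr_ge0 ?normr_ge0 ?ler0n //.
by rewrite (le_trans (ler_normD _ _)) // lerD // fM // ltnW.
Qed.

(** Counterclockwise along the boundary of the square with lower left corner [p]
    and side [m * h]; the top and left sides are traversed backwards, whence the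
    signs. *)
Definition sqsum f p h m : C :=
  trap f p h m + trap f (p + m%:R * h) (ii * h) m
  - trap f (p + ii * (m%:R * h)) h m - trap f p (ii * h) m.

(** The inner edges are traversed once in each direction and cancel exactly, with
    no passage to the limit, because the four quarters share the mesh [h]. *)
Lemma sqsum_split f p h m :
  sqsum f p h (m + m) =
  sqsum f p h m + sqsum f (p + m%:R * h) h m +
  sqsum f (p + ii * (m%:R * h)) h m + sqsum f (p + m%:R * h + ii * (m%:R * h)) h m.
Proof.
rewrite /sqsum !trap_cat.
have E1 : m%:R * (ii * h) = ii * (m%:R * h) by rewrite mulrCA.
rewrite natrD !E1 !mulrDl ?mulrDr !addrA.
have -> : p + ii * (m%:R * h) + ii * (m%:R * h) + m%:R * h =
          p + m%:R * h + ii * (m%:R * h) + ii * (m%:R * h) by ring.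
have -> : p + ii * (m%:R * h) + m%:R * h = p + m%:R * h + ii * (m%:R * h) by ring.
have -> : p + m%:R * h + ii * (m%:R * h) + m%:R * h =
          p + m%:R * h + m%:R * h + ii * (m%:R * h) by ring.
ring.
Qed.

Lemma sqsum_lin f g (c : C) p h m :
  sqsum (fun z => f z + c * g z) p h m = sqsum f p h m + c * sqsum g p h m.
Proof. by rewrite /sqsum !trap_lin; ring. Qed.

(** The trapezoidal rule is exact on affine functions, and a closed contour gives
    back the same value of the primitive. *)
Lemma sqsum_affine (a b : C) p h m : sqsum (fun z => a + b * z) p h m = 0.
Proof. by rewrite /sqsum !trap_affine /=; by field. Qed.

Definition in_square (p : C) (s : R) (z : C) : Prop :=
  Re p <= Re z <= Re p + s /\ Im p <= Im z <= Im p + s.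

Definition on_boundary (p : C) (s : R) (z : C) : Prop :=
  in_square p s z /\ [\/ Re z = Re p, Re z = Re p + s, Im z = Im p | Im z = Im p + s].

Lemma natC_mul m (x : R) : m%:R * x%:C%C = (m%:R * x)%:C%C :> C.
Proof. by rewrite rmorphM rmorph_nat. Qed.

Lemma sqsum_le f p (s : R) m (M : C) : 0 <= s -> (0 < m)%N ->
  (forall z, on_boundary p s z -> `|f z| <= M) ->
  `|sqsum f p (s / m%:R)%:C%C m| <= M * (4 * s)%:C%C.
Proof.
move=> s0 m0 fM.
have m0' : m%:R != 0 :> R by rewrite pnatr_eq0 -lt0n.
have frac k : (k <= m)%N -> 0 <= k%:R * (s / m%:R) <= s.
  move=> km; rewrite mulr_ge0 ?divr_ge0 ?ler0n //=.
  by rewrite mulrCA ler_piMr // ler_pdivrMr ?ltr0n // mul1r ler_nat.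
have iR x : ii * x%:C%C = (0 +i* x)%C by simpc.
have full : m%:R * (s / m%:R) = s by rewrite mulrCA divff ?mulr1.
have side q d : `|d| = (s / m%:R)%:C%C ->
    (forall k, (k <= m)%N -> on_boundary p s (q + k%:R * d)) ->
    `|trap f q d m| <= M * s%:C%C.
  move=> dE qd; apply: le_trans (trap_le (fun k km => fM _ (qd k km))) _.
  by rewrite dE natC_mul full.
have nh : `|(s / m%:R)%:C%C : C| = (s / m%:R)%:C%C.
  by rewrite ger0_norm // ler0c divr_ge0.
have nih : `|ii * (s / m%:R)%:C%C| = (s / m%:R)%:C%C.
  by rewrite normrM nh normc_def /= expr0n /= add0r expr1n sqrtr1 mul1r.
have -> : M * (4 * s)%:C%C = M * s%:C%C + M * s%:C%C + M * s%:C%C + M * s%:C%C.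
  by rewrite rmorphM /= rmorph_nat; ring.
rewrite /sqsum !natC_mul full (iR s).
rewrite (le_trans (ler_normB _ _)) // lerD //; last first.
  apply: side => // k /frac /andP[k0 ks]; rewrite mulrCA natC_mul iR.
  case: p {fM} => a b; rewrite /on_boundary /in_square /= !addr0.
  by split; [split; apply/andP; split; lra|apply: Or41].
rewrite (le_trans (ler_normB _ _)) // lerD //; last first.
  apply: side => // k /frac /andP[k0 ks]; rewrite natC_mul.
  case: p {fM} => a b; rewrite /on_boundary /in_square /= !addr0.
  by split; [split; apply/andP; split; lra|apply: Or44].
rewrite (le_trans (ler_normD _ _)) // lerD //.
  apply: side => // k /frac /andP[k0 ks]; rewrite natC_mul.
  case: p {fM} => a b; rewrite /on_boundary /in_square /= !addr0.
  by split; [split; apply/andP; split; lra|apply: Or43].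
apply: side => // k /frac /andP[k0 ks]; rewrite mulrCA natC_mul iR.
case: p {fM} => a b; rewrite /on_boundary /in_square /= !addr0.
by split; [split; apply/andP; split; lra|apply: Or42].
Qed.

Lemma sqsum_eq f g p (s : R) m : 0 <= s -> (0 < m)%N ->
  (forall z, on_boundary p s z -> f z = g z) ->
  sqsum f p (s / m%:R)%:C%C m = sqsum g p (s / m%:R)%:C%C m.
Proof.
move=> s0 m0 fg; apply/eqP; rewrite -subr_eq0 -normr_le0.
have -> : sqsum f p (s / m%:R)%:C%C m - sqsum g p (s / m%:R)%:C%C m =
   sqsum (fun z => f z + -1 * g z) p (s / m%:R)%:C%C m.
  by rewrite sqsum_lin mulN1r.
rewrite -(mul0r (4 * s)%:C%C); apply: sqsum_le => // z /fg ->.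
by rewrite mulN1r subrr normr0.
Qed.

End Trapezoid.

(** * Goursat's bisection *)

Section RealAux.
Variable R : realType.

Lemma nested_intervals (a s : nat -> R) : (forall n, 0 <= s n) ->
  (forall n, a n <= a n.+1) -> (forall n, a n.+1 + s n.+1 <= a n + s n) ->
  exists x, forall n, a n <= x <= a n + s n.
Proof.
move=> s0 /nondecreasing_seqP ha /nonincreasing_seqP hb.
have ub m n : a m <= a n + s n.
  have [mn|/ltnW nm] := leqP m n.
    by rewrite (le_trans (ha _ _ mn)) // lerDl.
  by rewrite (le_trans _ (hb _ _ nm)) // lerDl.
exists (sup (range a)) => n; apply/andP; split.
  apply: sup_upper_bound; last by exists n.
  by split; [exists (a 0), 0%N|exists (a 0%N + s 0%N) => _ [m _ <-]].
by apply: ge_sup => [|_ [m _ <-]]; [exists (a 0), 0%N|].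
Qed.

Lemma half_pow_lt (s d : R) : 0 < d -> exists n, s / 2 ^+ n < d.
Proof.
move=> d0; have [s0|s0] := leP s 0; first by exists 0%N; rewrite divr1 (le_lt_trans s0).
exists (Num.Def.archi_bound (s / d)).
rewrite ltr_pdivrMr ?exprn_gt0 // mulrC -ltr_pdivrMr //.
have sd0 : 0 <= s / d by rewrite divr_ge0 // ltW.
by rewrite (lt_le_trans (archi_boundP sd0)) // -natrX ler_nat ltnW // ltn_expl.
Qed.

(** Its increments have the density [1 / (2 sqrt |t|)], integrable but infinite
    at 0. *)
Definition ssqrt (t : R) := if 0 <= t then Num.sqrt t else - Num.sqrt (- t).

Lemma ssqrt_homo : {homo ssqrt : x y / x <= y}.
Proof.
move=> x y xy; rewrite /ssqrt; case: (leP 0 x) => x0; case: (leP 0 y) => y0.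
- by rewrite ler_wsqrtr.
- by move: (le_lt_trans (le_trans x0 xy) y0); rewrite ltxx.
- by rewrite (@le_trans _ _ 0) ?oppr_le0 ?sqrtr_ge0.
- by rewrite lerN2 ler_wsqrtr // lerN2.
Qed.

Definition ssqrt_incr (u a s : R) := ssqrt (a + s - u) - ssqrt (a - u).

Lemma ssqrt_incr_ge0 (u a s : R) : 0 <= s -> 0 <= ssqrt_incr u a s.
Proof. by move=> s0; rewrite subr_ge0 ssqrt_homo // lerB // lerDl. Qed.

Lemma ssqrt_incr_ge (u a s : R) : a <= u <= a + s -> Num.sqrt s <= ssqrt_incr u a s.
Proof.
move=> /andP[au us]; rewrite /ssqrt_incr.
have -> : ssqrt (a + s - u) = Num.sqrt (a + s - u) by rewrite /ssqrt subr_ge0 us.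
have -> : ssqrt (a - u) = - Num.sqrt (u - a).
  rewrite /ssqrt subr_ge0; case: ifPn => [ua|_]; last by rewrite opprB.
  have -> : u = a by apply/eqP; rewrite eq_le ua au.
  by rewrite subrr sqrtr0 oppr0.
rewrite opprK -(@ler_pXn2r _ 2) ?nnegrE ?addr_ge0 ?sqrtr_ge0 //.
rewrite sqrrD !sqr_sqrtr ?subr_ge0 //; last by lra.
have := mulr_ge0 (sqrtr_ge0 (a + s - u)) (sqrtr_ge0 (u - a)); lra.
Qed.

End RealAux.

Section Goursat.
Variable R : realType.
Local Notation C := (R[i]).
Local Notation ii := ('i%C : C).
Local Notation Re := (@complex.Re R).
Local Notation Im := (@complex.Im R).
Implicit Types (f g : C -> C) (p q w z : C) (r s e d : R).

(** Otherwise bisection gives nested squares on which [P] fails; they shrink to a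
    point, near which [P] holds by assumption. *)
Lemma square_cousin (P : C -> R -> Prop) :
  (forall q r, 0 < r -> P q (r / 2) -> P (q + (r / 2)%:C%C) (r / 2) ->
    P (q + ii * (r / 2)%:C%C) (r / 2) ->
    P (q + (r / 2)%:C%C + ii * (r / 2)%:C%C) (r / 2) -> P q r) ->
  forall p s, 0 < s ->
  (forall z, in_square p s z -> exists2 d, 0 < d &
    forall q r, 0 < r < d -> in_square q r z -> P q r) ->
  P p s.
Proof.
move=> Psplit p s s0 Ploc; apply: contrapT => nP.
have step (x : C * R) : exists q, 0 < x.2 -> ~ P x.1 x.2 ->
    [/\ ~ P q (x.2 / 2), Re x.1 <= Re q <= Re x.1 + x.2 / 2 &
      Im x.1 <= Im q <= Im x.1 + x.2 / 2].
  case: x => -[a b] r /=.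
  have [r0|r0] := leP r 0; first by exists 0.
  apply: contrapT => /forallNP nq.
  have Pq u v : a <= u <= a + r / 2 -> b <= v <= b + r / 2 -> P (u +i* v)%C (r / 2).
    by move=> ua vb; apply: contrapT => nPq; apply: (nq (u +i* v)%C) => _ _; split.
  apply: (nq 0) => _ []; apply: Psplit => //; simpc; apply: Pq; lra.
have {step}[nx nxP] := choice step.
pose x n : C * R := iter n (fun x => (nx x, x.2 / 2)) (p, s).
have xr n : (x n).2 = s / 2 ^+ n.
  elim: n => [|n IH]; first by rewrite divr1.
  by rewrite [LHS]/= -/(x n) IH exprSr invfM mulrA.
have xr0 n : 0 < (x n).2 by rewrite xr divr_gt0 ?exprn_gt0.
have xP n : ~ P (x n).1 (x n).2.
  by elim: n => // n IH; have [] := nxP (x n) (xr0 n) IH.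
have [u uP] : exists u, forall n, Re (x n).1 <= u <= Re (x n).1 + (x n).2.
  apply: nested_intervals => n; first exact: ltW.
    by have [_ + _] := nxP (x n) (xr0 n) (xP n) => /andP[].
  by have [_ + _] := nxP (x n) (xr0 n) (xP n) => /=; lra.
have [v vP] : exists u, forall n, Im (x n).1 <= u <= Im (x n).1 + (x n).2.
  apply: nested_intervals => n; first exact: ltW.
    by have [_ _ +] := nxP (x n) (xr0 n) (xP n) => /andP[].
  by have [_ _ +] := nxP (x n) (xr0 n) (xP n) => /=; lra.
have [|d d0 dP] := Ploc (u +i* v)%C; first by split => /=; [exact: (uP 0%N)|exact: (vP 0%N)].
have [n nd] := half_pow_lt s d0.
by apply: (xP n); apply: dP; rewrite ?xr0 ?xr //; split; rewrite -xr.
Qed.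

(** The mass of a square for the density [1 / (4 sqrt (|x - u| |y - v|))], where
    [w = u + iv].  It is additive under subdivision, and a square of side [r]
    through [w] has mass at least [r], not merely [r ^+ 2]. *)
Definition sqrt_weight w q r : R := ssqrt_incr (Re w) (Re q) r * ssqrt_incr (Im w) (Im q) r.

Lemma sqrt_weight_ge0 w q r : 0 <= r -> 0 <= sqrt_weight w q r.
Proof. by move=> r0; rewrite mulr_ge0 // ssqrt_incr_ge0. Qed.

Lemma sqrt_weight_ge w q r : 0 <= r -> in_square q r w -> r <= sqrt_weight w q r.
Proof.
move=> r0 [wx wy]; rewrite -{1}(sqr_sqrtr r0) expr2.
by rewrite ler_pM ?sqrtr_ge0 // ssqrt_incr_ge.
Qed.

Lemma sqrt_weight_split w q r :
  sqrt_weight w q r = sqrt_weight w q (r / 2) + sqrt_weight w (q + (r / 2)%:C%C) (r / 2) +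
    sqrt_weight w (q + ii * (r / 2)%:C%C) (r / 2) +
    sqrt_weight w (q + (r / 2)%:C%C + ii * (r / 2)%:C%C) (r / 2).
Proof.
case: q => a b; simpc; rewrite /sqrt_weight /ssqrt_incr /=.
have E (t : R) : t + r / 2 + r / 2 = t + r by field.
by rewrite !E; ring.
Qed.

(** The meshes are the dyadic ones, so that those of a square and of its quarters
    match. *)
Definition eventually_small f p s e := exists K, forall k, (K <= k)%N ->
  `|sqsum f p (s / (2 ^ k)%:R)%:C%C (2 ^ k)| <= e%:C%C.

Lemma eventually_small_split f p s e1 e2 e3 e4 :
  eventually_small f p (s / 2) e1 -> eventually_small f (p + (s / 2)%:C%C) (s / 2) e2 ->
  eventually_small f (p + ii * (s / 2)%:C%C) (s / 2) e3 ->
  eventually_small f (p + (s / 2)%:C%C + ii * (s / 2)%:C%C) (s / 2) e4 ->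
  eventually_small f p s (e1 + e2 + e3 + e4).
Proof.
move=> [K1 h1] [K2 h2] [K3 h3] [K4 h4].
exists (maxn (maxn K1 K2) (maxn K3 K4)).+1 => -[//|k]; rewrite ltnS !geq_max.
move=> /andP[/andP[/h1 k1 /h2 k2] /andP[/h3 k3 /h4 k4]].
have n0 : (2 ^ k)%:R != 0 :> R by rewrite pnatr_eq0 -lt0n expn_gt0.
have -> : s / (2 ^ k.+1)%:R = s / 2 / (2 ^ k)%:R.
  by rewrite expnS natrM invfM mulrA.
rewrite expnS mul2n -addnn sqsum_split natC_mul [_ * (s / 2 / _)]mulrCA divff // mulr1.
rewrite !rmorphD /=; do 3 rewrite (le_trans (ler_normD _ _)) // lerD //.
Qed.

(** Complex differentiability at [z], with real bounds. *)
Definition cdiff f z := exists l : C, forall e, 0 < e -> exists2 d, 0 < d &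
  forall z', `|z' - z| < d%:C%C -> `|f z' - f z - l * (z' - z)| <= e%:C%C * `|z' - z|.

Definition ccont f z := forall e, 0 < e -> exists2 d, 0 < d &
  forall z', `|z' - z| < d%:C%C -> `|f z' - f z| <= e%:C%C.

Lemma normc_le z : `|z| <= (`|Re z| + `|Im z|)%:C%C.
Proof.
rewrite [X in `|X|]complexE (le_trans (ler_normD _ _)) // rmorphD /= lerD //.
  by rewrite normc_def /= expr0n /= addr0 sqrtr_sqr.
rewrite normrM normc_def /= expr0n /= add0r expr1n sqrtr1 mul1r.
by rewrite normc_def /= expr0n /= addr0 sqrtr_sqr.
Qed.

Lemma in_square_dist q r z z' : in_square q r z -> in_square q r z' ->
  `|z' - z| <= (2 * r)%:C%C.
Proof.
case: q z z' => a b [x y] [x' y'] [/= h1 h2] [/= h3 h4].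
rewrite (le_trans (normc_le _)) // lecR /=.
have hx : `|x' - x| <= r by rewrite ler_norml; lra.
have hy : `|y' - y| <= r by rewrite ler_norml; lra.
lra.
Qed.

(** Bisection with the target [c * (r ^+ 2 + sqrt_weight w q r)] for a square of
    side [r].  Away from [w] the affine approximation of [f] leaves a sum
    [o(r ^+ 2)].  At [w] only continuity is available, which gives [o(r)]; this is
    still absorbed by the weight of the squares through [w]. *)
Lemma goursat f w p s : 0 < s ->
  (forall z, in_square p s z -> z != w -> cdiff f z) -> ccont f w ->
  forall e, 0 < e -> eventually_small f p s e.
Proof.
move=> s0 fd fw e e0.
have W0 : 0 < s ^+ 2 + sqrt_weight w p s by rewrite ltr_wpDr ?sqrt_weight_ge0 ?exprn_gt0 // ltW.
pose c := e / (s ^+ 2 + sqrt_weight w p s).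
have c0 : 0 < c by rewrite divr_gt0.
have -> : e = c * (s ^+ 2 + sqrt_weight w p s) by rewrite /c divfK ?gt_eqF.
apply: (@square_cousin (fun q r => eventually_small f q r (c * (r ^+ 2 + sqrt_weight w q r)))) => //.
  move=> q r r0 h1 h2 h3 h4; have := eventually_small_split h1 h2 h3 h4.
  congr eventually_small; rewrite (sqrt_weight_split w q r); by field.
move=> z zp.
(* Subtracting an affine function does not change the sum. *)
have loc a l q r (e' : R) k : 0 < r ->
    (forall z', in_square q r z' -> `|f z' + -1 * (a + l * z')| <= e'%:C%C) ->
    `|sqsum f q (r / (2 ^ k)%:R)%:C%C (2 ^ k)| <= (4 * r * e')%:C%C.
  move=> r0 h.
  have -> : sqsum f q (r / (2 ^ k)%:R)%:C%C (2 ^ k) =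
      sqsum (fun z' => f z' + -1 * (a + l * z')) q (r / (2 ^ k)%:R)%:C%C (2 ^ k).
    by rewrite sqsum_lin sqsum_affine mulr0 addr0.
  have -> : (4 * r * e')%:C%C = e'%:C%C * (4 * r)%:C%C :> C by rewrite -rmorphM mulrC.
  apply: sqsum_le; [exact: ltW|by rewrite expn_gt0|move=> z' [+ _]].
  exact: h.
have [->|zw] := eqVneq z w.
  have [d d0 dP] := fw (c / 4) (divr_gt0 c0 (ltr0n _ 4)).
  exists (d / 2); first by rewrite divr_gt0.
  move=> q r /andP[r0 rd] wq; exists 0%N => k _.
  rewrite (le_trans (loc (f w) 0 q r (c / 4) k r0 _)) //.
    move=> z' zq; rewrite mul0r addr0 mulN1r dP //.
    by rewrite (le_lt_trans (in_square_dist wq zq)) // ltcR; lra.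
  rewrite lecR; have -> : 4 * r * (c / 4) = c * r by field.
  by rewrite ler_wpM2l ?(ltW c0) // (le_trans (sqrt_weight_ge (ltW r0) wq)) // lerDr sqr_ge0.
have [l lP] := fd z zp zw.
have [d d0 dP] := lP (c / 8) (divr_gt0 c0 (ltr0n _ 8)).
exists (d / 2); first by rewrite divr_gt0.
move=> q r /andP[r0 rd] zq; exists 0%N => k _.
rewrite (le_trans (loc (f z - l * z) l q r (c / 8 * (2 * r)) k r0 _)) //.
  move=> z' zq'; have dz := in_square_dist zq zq'.
  have -> : f z' + -1 * (f z - l * z + l * z') = f z' - f z - l * (z' - z) by ring.
  apply: le_trans (dP _ _) _; first by apply: le_lt_trans dz _; rewrite ltcR; lra.
  by rewrite (rmorphM _ (c / 8)); apply: ler_wpM2l => //; rewrite ler0c divr_ge0 // ltW.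
rewrite lecR; have -> : 4 * r * (c / 8 * (2 * r)) = c * r ^+ 2 by field.
by rewrite ler_wpM2l ?(ltW c0) // lerDl sqrt_weight_ge0 // ltW.
Qed.

End Goursat.

(** * Compactness and generalized limits in the complex plane *)

Section ComplexPlane.
Variable R : realType.
Local Notation C := (CC R).
Local Notation ii := ('i%C : R[i]).
Local Notation Re := (@complex.Re R).
Local Notation Im := (@complex.Im R).

Lemma gt0_realC (e : R[i]) : 0 < e -> exists2 d : R, 0 < d & e = d%:C%C.
Proof.
case: e => a b; rewrite ltcE /= => /andP[/eqP b0 a0].
by exists a => //; rewrite b0.
Qed.

Lemma continuous_realC : continuous (fun x : R => x%:C%C : C).
Proof.
move=> x; apply/cvgrPdist_lt => e /gt0_realC[d d0 ->].
near=> y; rewrite -rmorphB normc_def /= expr0n /= addr0 sqrtr_sqr ltcR.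
near: y; exact: (@cvgrPdist_lt _ _ _ _ _ id x).1.
Unshelve. all: by end_near. Qed.

Definition ReIm (p : R * R) : C := p.1%:C%C + ii * p.2%:C%C.

Lemma continuous_ReIm : continuous ReIm.
Proof.
move=> p; apply: cvgD.
  by apply: (cvg_comp fst (fun x : R => x%:C%C : C)); [exact: cvg_fst|exact: continuous_realC].
apply: cvgMr.
by apply: (cvg_comp snd (fun x : R => x%:C%C : C)); [exact: cvg_snd|exact: continuous_realC].
Qed.

Definition bsquare (M : R) : set C := ReIm @` (`[-M, M] `*` `[-M, M]).

Lemma compact_bsquare (M : R) : compact (bsquare M).
Proof.
apply: continuous_compact; first exact/continuous_subspaceT/continuous_ReIm.
by apply: compact_setX; exact: segment_compact.
Qed.

Lemma bsquareP (M : R) (z : C) : `|z| <= M%:C%C -> bsquare M z.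
Proof.
move=> zM; exists (Re z, Im z); last by rewrite /ReIm /= -complexE.
have rM := le_trans (normc_ge_Re z) zM.
have iM : `|Im z|%:C%C <= M%:C%C.
  apply: le_trans zM; rewrite normc_def lecR -sqrtr_sqr ler_wsqrtr // lerDr sqr_ge0 //.
by split => /=; rewrite in_itv /= -ler_norml -lecR.
Qed.

Definition ubounded (u : nat -> C) := exists M : R, forall n, `|u n| <= M%:C%C.

Definition limit_along (G : set_system nat) (u : nat -> C) (l : C) :=
  forall e : R, 0 < e -> G [set n | `|u n - l| <= e%:C%C].

Lemma limit_along_unique (G : set_system nat) u l l' : ProperFilter G ->
  limit_along G u l -> limit_along G u l' -> l = l'.
Proof.
move=> GF ul ul'; apply/eqP; rewrite -subr_eq0 -normr_le0.
apply/ler_addgt0Pr => _ /gt0_realC[e e0 ->]; rewrite add0r.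
have e2 : 0 < e / 2 by rewrite divr_gt0.
have [n [/= h h']] := @filter_ex _ G _ _ (filterI (ul _ e2) (ul' _ e2)).
have -> : l - l' = (u n - l') - (u n - l) by ring.
by rewrite (le_trans (ler_normB _ _)) // [e]splitr rmorphD lerD.
Qed.

Lemma limit_along_exists (G : set_system nat) u : UltraFilter G -> ubounded u ->
  exists l, limit_along G u l.
Proof.
move=> GU [M uM].
have [|l [_ ul]] := @compact_bsquare M (u @ G).
  by rewrite /fmap /=; apply: (@filterE _ G) => n; exact/bsquareP/uM.
exists l => e e0.
have [//|GB] := in_ultra_setVsetC [set n | `|u n - l| <= e%:C%C] GU.
have lB : nbhs l [set z : C | `|l - z| < e%:C%C].
  by apply: nbhsx_ballx; rewrite ltcR.
have [c [nc /= lc]] := ul (~` [set z : C | `|z - l| <= e%:C%C]) _ GB lB.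
by case: nc => /=; rewrite distrC ltW.
Qed.

(** The limit along an ultrafilter finer than the neighbourhoods of infinity: it
    makes discrete sums converge without any estimate on their oscillation, and
    it is linear. *)
Lemma ultralimit : exists L : (nat -> C) -> C,
  [/\ forall c, L (fun=> c) = c,
      forall u v c, ubounded u -> ubounded v ->
        L (fun n => u n + c * v n) = L u + c * L v &
      forall u (B : R), ubounded u -> (exists K, forall k, (K <= k)%N -> `|u k| <= B%:C%C) ->
        `|L u| <= B%:C%C].
Proof.
have [G [GU GN]] := @ultraFilterLemma nat \oo _.
pose L u := xget 0 (limit_along G u).
have Lu u : ubounded u -> limit_along G u (L u).
  by move=> /(limit_along_exists GU)[l ul]; exact: (xgetI 0 ul).
have LE u l : limit_along G u l -> L u = l.
  by move=> ul; exact: (limit_along_unique _ (xgetI 0 ul) ul).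
exists L; split.
- by move=> c; apply: LE => e e0; apply: filterE => n /=; rewrite subrr normr0 ler0c ltW.
- move=> u v c /Lu ul /Lu vl; apply: LE => e e0.
  have [d d0 dE] : exists2 d : R, 0 < d & d%:C%C = 1 + `|c|.
    have /gt0_realC[d d0 dE] : 0 < 1 + `|c| by rewrite ltr_pwDl.
    by exists d.
  have e1 : 0 < e / d by rewrite divr_gt0.
  apply: filterS (filterI (ul _ (divr_gt0 e0 (ltr0n _ 2))) (vl _ (divr_gt0 e1 (ltr0n _ 2)))).
  move=> n [/= h1 h2].
  have -> : u n + c * v n - (L u + c * L v) = (u n - L u) + c * (v n - L v) by ring.
  rewrite (le_trans (ler_normD _ _)) // [e]splitr rmorphD /= lerD // normrM.
  have -> : (e / 2)%:C%C = d%:C%C * (e / d / 2)%:C%C :> C.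
    by rewrite -rmorphM /=; congr (_%:C%C); field; rewrite gt_eqF.
  by rewrite ler_pM // dE lerDr.
- move=> u B /Lu ul [K uK].
  have Gn : G [set k | `|u k| <= B%:C%C] by apply: GN; exists K.
  apply/ler_addgt0Pr => _ /gt0_realC[e e0 ->].
  have [k [/= dk uk]] := @filter_ex _ G _ _ (filterI (ul e e0) Gn).
  have -> : L u = u k - (u k - L u) by ring.
  by rewrite (le_trans (ler_normB _ _)) // lerD.
Qed.

Lemma differentiable_cdiff (f : C -> C) (z : C) : differentiable f z -> cdiff f z.
Proof.
move=> fz; exists ('d f z 1) => e e0.
have e0' : 0 < (e%:C%C : R[i]) by rewrite ltcR.
have fo := diff_locally fz.
have [r /= r0 rP] := (eqaddoP _ _ _ _).1 fo _ e0'.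
case: (gt0_realC r0) rP => d d0 -> rP; exists d => // z' zd.
have lin : 'd f z (z' - z) = 'd f z 1 * (z' - z).
  by rewrite -[in LHS](mulr1 (z' - z)) -[_ * 1]/(_ *: (1 : C)) linearZ /= mulrC.
have := rP (z' - z); rewrite /= sub0r normrN => /(_ zd).
by rewrite !fctE /= subrK lin opprD addrA.
Qed.
End ComplexPlane.

(** * The boundary of the square of side 2 about the origin *)

Section Contour.
Variable R : realType.
Local Notation C := (CC R).
Local Notation ii := ('i%C : R[i]).

Lemma cdiff_near (f g : C -> C) z (d : R) : 0 < d ->
  (forall z', `|z' - z| < d%:C%C -> f z' = g z') -> cdiff g z -> cdiff f z.
Proof.
move=> d0 fg [l gl]; exists l => e e0; have [r r0 rP] := gl e e0.
exists (Num.min d r); first by rewrite lt_min d0.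
move=> z' h; rewrite !fg ?rP //.
- by apply: lt_le_trans h _; rewrite lecR ge_min lexx orbT.
- by rewrite subrr normr0 ltcR.
- by apply: lt_le_trans h _; rewrite lecR ge_min lexx.
Qed.

(** The difference quotient, with the value [l] at the exceptional point [w]. *)
Definition slope (f : C -> C) (w l z : C) : C :=
  if z == w then l else (f z - f w) / (z - w).

Lemma slope_cdiff f w l z : z != w -> differentiable f z -> cdiff (slope f w l) z.
Proof.
move=> zw fz.
have [d d0 dE] : exists2 d : R, 0 < d & `|z - w| = d%:C%C.
  by apply: gt0_realC; rewrite normr_gt0 subr_eq0.
(* The disc of radius [|z - w|] about [z] avoids [w]. *)
apply: (@cdiff_near _ (fun z => (f z - f w) * (z - w)^-1) _ _ d0).
  move=> z' dz'; rewrite /slope; case: eqP => // z'w.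
  by move: dz'; rewrite z'w distrC dE ltxx.
apply: differentiable_cdiff; apply: differentiableM.
  by apply: differentiableB; [exact: fz|exact: differentiable_cst].
apply: differentiableV; last by rewrite subr_eq0.
by apply: differentiableB; [exact: ex_diff|exact: differentiable_cst].
Qed.

Lemma slope_ccont f w : cdiff f w -> exists l, ccont (slope f w l) w.
Proof.
move=> [l lP]; exists l => e e0; have [d d0 dP] := lP e e0.
exists d => // z' zd; rewrite /slope eqxx; case: eqP => [_|/eqP zw].
  by rewrite subrr normr0 ler0c ltW.
have zw0 : z' - w != 0 by rewrite subr_eq0.
have -> : (f z' - f w) / (z' - w) - l = (f z' - f w - l * (z' - w)) / (z' - w).
  by field.
by rewrite normrM normfV ler_pdivrMr ?normr_gt0 // dP.
Qed.

Definition corner : R[i] := - 1 - ii.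
Definition mesh k : R[i] := (2 / (2 ^ k)%:R)%:C%C.
Definition contour (f : C -> C) k : C := sqsum f corner (mesh k) (2 ^ k).

Lemma pow2R_neq0 k : (2 ^ k)%:R != 0 :> R.
Proof. by rewrite pnatr_eq0 -lt0n expn_gt0. Qed.

Lemma full_side k : (2 ^ k)%:R * mesh k = 2 :> R[i].
Proof. by rewrite natC_mul mulrCA divff ?pow2R_neq0 // mulr1 rmorph_nat. Qed.

Lemma on_boundary_ge1 z : on_boundary corner 2 z -> 1 <= `|z|.
Proof.
case: z => x y []; rewrite /in_square /= => _; rewrite /= normc_def /=.
have -> : 1 = (Num.sqrt 1)%:C%C :> C by rewrite sqrtr1.
rewrite lecR => h; rewrite ler_wsqrtr //.
have h1 : 0 <= x ^+ 2 by exact: sqr_ge0.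
have h2 : 0 <= y ^+ 2 by exact: sqr_ge0.
by case: h => ->; nra.
Qed.

Lemma in_square_small z : `|z| <= 1 -> in_square corner 2 z.
Proof.
move=> z1; have z1' : `|z| <= 1%:C%C by [].
have [[x y] [/= hx hy] <-] := bsquareP z1'.
by move: hx hy; rewrite /in_square /= !in_itv /= => /andP[? ?] /andP[? ?]; split; apply/andP; split; lra.
Qed.

Lemma contour_le f k M : (forall z, on_boundary corner 2 z -> `|f z| <= M) ->
  `|contour f k| <= M * 8.
Proof.
move=> fM; have := @sqsum_le _ f corner 2 (2 ^ k) M (ler0n _ _) _ fM.
rewrite expn_gt0 => /(_ isT).
by rewrite -natrM rmorph_nat.
Qed.

Lemma contour_eq f g k : (forall z, on_boundary corner 2 z -> f z = g z) ->
  contour f k = contour g k.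
Proof. move=> fg; rewrite /contour /mesh.
apply: (sqsum_eq _ _ fg); first exact: ler0n.
by rewrite expn_gt0. Qed.

Lemma contour_lin f g (c : C) k :
  contour (fun z => f z + c * g z) k = contour f k + c * contour g k.
Proof. exact: sqsum_lin. Qed.

Lemma trapZ (f : C -> C) (c : C) (p d : R[i]) m :
  trap (fun z => c * f z) p d m = c * trap f p d m.
Proof.
by rewrite /trap mulr_sumr; apply: eq_bigr => k _; rewrite -mulrDr -mulrA.
Qed.

(** The four sides are the images of the bottom one under the powers of [i]. *)
Lemma contour_rot f (c : C) k : (forall z, f (ii * z) = c * f z) ->
  contour f k = (1 + ii * c + (ii * c) ^+ 2 + (ii * c) ^+ 3) * trap f corner (mesh k) (2 ^ k).
Proof.
move=> fc; set T := trap f corner (mesh k) (2 ^ k).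
have rot p d m : trap f (ii * p) (ii * d) m = ii * c * trap f p d m.
  by rewrite trap_scale (_ : (fun z => _) = (fun z => c * f z)) ?trapZ ?mulrA //; apply/funext => z.
have i2 : ii * ii = -1 by rewrite -expr2 sqr_i.
have iix x : ii * (ii * x) = - x by rewrite mulrA i2 mulN1r.
have E1 : corner + (2 ^ k)%:R * mesh k = ii * corner.
  by rewrite full_side /corner mulrBr i2; ring.
have E2 : corner + ii * ((2 ^ k)%:R * mesh k) = ii * (ii * (ii * corner)).
  by rewrite full_side !iix /corner mulrBr i2; ring.
have E3 : ii * (ii * (ii * corner)) + (2 ^ k)%:R * mesh k = ii * (ii * corner).
  by rewrite full_side !iix /corner mulrBr i2; ring.
have E4 : corner + (2 ^ k)%:R * (ii * mesh k) = ii * (ii * (ii * corner)).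
  by rewrite mulrCA E2.
rewrite /contour /sqsum E1 E2 rot -/T.
have -> : - trap f (ii * (ii * (ii * corner))) (mesh k) (2 ^ k) = (ii * c) ^+ 2 * T.
  rewrite -trap_rev E3.
  have -> : - mesh k = ii * (ii * mesh k) by rewrite mulrA i2 mulN1r.
  by rewrite !rot mulrA.
have -> : - trap f corner (ii * mesh k) (2 ^ k) = (ii * c) ^+ 3 * T.
  rewrite -trap_rev E4.
  have -> : - (ii * mesh k) = ii * (ii * (ii * mesh k)) by rewrite (mulrA ii ii) i2; ring.
  by rewrite !rot -/T; ring.
by rewrite !mulrDl mul1r.
Qed.

End Contour.
Arguments corner {R}.
Arguments mesh {R} k.

Section Winding.
Variable R : realType.
Local Notation C := (CC R).
Local Notation ii := ('i%C : R[i]).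
Local Notation Im := (@complex.Im R).

Lemma invi : ii^-1 = - ii.
Proof.
have i0 : ii != 0 by rewrite eq_complex /= oner_eq0 andbF.
by apply: (mulfI i0); rewrite divff // mulrN -expr2 sqr_i opprK.
Qed.

(** The quarter turn multiplies the contributions of successive sides by a power
    [u] of [- i] with [1 + u + u ^+ 2 + u ^+ 3 = 0]. *)
Lemma contour_inv_pow n k : (0 < n < 4)%N -> contour (fun z : C => z^-1 ^+ n.+1) k = 0.
Proof.
move=> n4; rewrite (@contour_rot _ _ ((- ii) ^+ n.+1)) => [|z]; last by rewrite invfM invi exprMn.
have i2 : ii * ii = -1 by rewrite -expr2 sqr_i.
have -> : ii * (- ii) ^+ n.+1 = (- ii) ^+ n by rewrite exprS mulrA mulrN i2 opprK mul1r.
set u := _ ^+ n; have -> : 1 + u + u ^+ 2 + u ^+ 3 = (1 + u) * (1 + u ^+ 2) by ring.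
rewrite {}/u; case: n n4 => [|[|[|[|n]]]] // _.
- by rewrite sqrrN sqr_i subrr mulr0 mul0r.
- by rewrite sqrrN sqr_i subrr !mul0r.
- by rewrite -exprM (exprM _ 2 3) sqrrN sqr_i -signr_odd /= expr1 subrr mulr0 mul0r.
Qed.

Lemma Im_inv_ge (x : R) : x ^+ 2 <= 1 -> 1 / 2 <= Im ((x +i* -1)%C^-1).
Proof.
move=> x1; have -> : Im ((x +i* -1)%C^-1) = - (-1 / (x ^+ 2 + (-1) ^+ 2)) by [].
rewrite mulNr opprK sqrrN expr1n.
by rewrite ler_pdivlMr ?ler_pdivrMr //; nra.
Qed.

(** An approximation of [2 pi i], by which the Taylor sums are normalized. *)
Definition winding k : C := contour (fun z => z^-1) k.

(** On the bottom side the imaginary part of [1 / z] is at least [1 / 2], and by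
    symmetry the four sides contribute equally. *)
Lemma winding_ge k : 4 <= `|winding k|.
Proof.
rewrite /winding (@contour_rot _ _ (- ii)) => [|z]; last by rewrite invfM invi.
rewrite mulrN -expr2 sqr_i opprK !expr1n; set T := trap _ _ _ _.
have -> : (1 + 1 + 1 + 1) * T = 4 * T by ring.
rewrite normrM (@ger0_norm _ 4) // -[X in X <= _]mulr1 ler_wpM2l //.
suff T1 : 1 <= Im T.
  have -> : 1 = 1%:C%C :> C by [].
  rewrite normc_def lecR (le_trans T1) // (le_trans (ler_norm _)) // -sqrtr_sqr.
  by rewrite ler_wsqrtr // lerDr sqr_ge0.
have m0 : 0 < (2 ^ k)%:R :> R by rewrite ltr0n expn_gt0.
have -> : 1 = \sum_(i < 2 ^ k) ((2 ^ k)%:R^-1 : R).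
  by rewrite sumr_const card_ord -[RHS]mulr_natl divff ?gt_eqF.
have -> : Im T = \sum_(i < 2 ^ k)
    Im ((((corner + i%:R * mesh k)^-1 + (corner + i.+1%:R * mesh k)^-1) * (mesh k / 2)) : R[i]).
  by apply: (big_morph Im) => // -[a b] [c d].
have pt i : (i <= 2 ^ k)%N -> 1 / 2 <= Im ((corner + i%:R * mesh k)^-1).
  move=> ik; have -> : corner + i%:R * mesh k = ((-1 + i%:R * (2 / (2 ^ k)%:R) : R) +i* -1)%C :> R[i].
    by rewrite /mesh natC_mul /corner; simpc.
  apply: Im_inv_ge; set t := i%:R * _; have : 0 <= t <= 2.
    apply/andP; split; first by apply: mulr_ge0 => //; apply: divr_ge0.
    by rewrite /t mulrCA; apply: ler_piMr => //; rewrite ler_pdivrMr // mul1r ler_nat.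
  by move=> /andP[]; nra.
apply: ler_sum => i _.
have -> : mesh k / 2 = ((2 ^ k)%:R^-1 : R)%:C%C.
  rewrite /mesh -(rmorph_nat (real_complex R) 2) -fmorphV -rmorphM /=.
  by congr (_%:C%C); field; rewrite gt_eqF.
have h1 := pt i (ltnW (ltn_ord i)); have h2 := pt i.+1 (ltn_ord i).
have ImM (z : R[i]) (r : R) : Im (z * r%:C%C) = Im z * r by case: z => a b; simpc.
have ImD (z z' : R[i]) : Im (z + z') = Im z + Im z' by case: z; case: z'.
by rewrite ImM ImD ler_peMl ?invr_ge0 ?ler0n //; lra.
Qed.

End Winding.
Arguments winding {R} k.

(** * Cauchy's formula and Taylor coefficients in one variable *)

Section Taylor.
Variable R : realType.
Local Notation C := (CC R).

Lemma on_boundary_dist (z w : C) : on_boundary corner 2 z -> `|w| <= 2^-1 -> 2^-1 <= `|z - w|.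
Proof.
move=> /on_boundary_ge1 z1 w1; have -> : 2^-1 = 1 - 2^-1 :> C by field.
by rewrite (le_trans _ (lerB_normD _ _)) // normrN lerB.
Qed.

Lemma on_boundary_neq0 (z w : C) : on_boundary corner 2 z -> `|w| <= 2^-1 -> z - w != 0.
Proof.
by move=> zb wb; rewrite -normr_gt0 (lt_le_trans _ (on_boundary_dist zb wb)) // invr_gt0.
Qed.

Lemma half0 : `|0 : C| <= 2^-1.
Proof. by rewrite normr0 invr_ge0. Qed.

(** The slope of [f] at [w] is differentiable outside [w] and continuous at [w],
    so that its contour sums tend to 0. *)
Lemma cauchy_formula (f : C -> C) (w : C) :
  (forall z : C, in_square corner 2 z -> differentiable f z) -> `|w| <= 2^-1 ->
  forall e : R, 0 < e -> exists K, forall k, (K <= k)%N ->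
  `|contour (fun z => f z * (z - w)^-1) k - f w * contour (fun z => (z - w)^-1) k| <= e%:C%C.
Proof.
move=> fd wb e e0.
have wsq : in_square corner 2 w.
  by apply: in_square_small; rewrite (le_trans wb) // invf_le1 // ler1n.
have [l lc] := slope_ccont (differentiable_cdiff (fd w wsq)).
have sl (z : C) : in_square corner 2 z -> z != w -> cdiff (slope f w l) z.
  by move=> zq zw; apply: slope_cdiff => //; exact: fd.
have [K KP] := goursat (ltr0n R 2) sl lc e0.
exists K => k /KP; congr (`|_| <= _).
rewrite -/(mesh k) -/(contour (slope f w l) k).
rewrite -mulNr -contour_lin; apply: contour_eq => z zb.
have := on_boundary_neq0 zb wb; rewrite subr_eq0 /slope => /negbTE ->.
by rewrite mulNr mulrBl.
Qed.

Lemma geometric (z w : C) : z != 0 -> z - w != 0 ->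
  (z - w)^-1 = z^-1 ^+ 1 + w * z^-1 ^+ 2 + w ^+ 2 * z^-1 ^+ 3 + w ^+ 3 * z^-1 ^+ 4
    + w ^+ 4 * (z^-1 ^+ 4 * (z - w)^-1).
Proof. by move=> z0 zw0; field; rewrite z0 zw0. Qed.

(** The Cauchy kernel is replaced by the first four terms of its geometric series;
    on the contour the remainder is at most [2 * |w| ^+ 4]. *)
Lemma kernel_expand (f : C -> C) (w : C) (M : R) k :
  (forall z : C, on_boundary corner 2 z -> `|f z| <= M%:C%C) -> `|w| <= 2^-1 ->
  `|contour (fun z => f z * (z - w)^-1) k -
    \sum_(j < 4) w ^+ j * contour (fun z => f z * z^-1 ^+ j.+1) k|
  <= (16 * M)%:C%C * `|w| ^+ 4.
Proof.
move=> fM wb.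
have -> : contour (fun z => f z * (z - w)^-1) k =
  contour (fun z => f z * z^-1 ^+ 1 + w * (f z * z^-1 ^+ 2) + w ^+ 2 * (f z * z^-1 ^+ 3)
    + w ^+ 3 * (f z * z^-1 ^+ 4)
    + w ^+ 4 * (f z * (z^-1 ^+ 4 * (z - w)^-1))) k.
  apply: contour_eq => z zb; rewrite [(z - w)^-1 in LHS]geometric ?(on_boundary_neq0 zb wb) //.
    by ring.
  by have := on_boundary_neq0 zb half0; rewrite subr0.
rewrite !contour_lin !big_ord_recl big_ord0 /= addr0 expr0 mul1r.
set X := contour (fun z => f z * (z^-1 ^+ 4 * (z - w)^-1)) k.
rewrite (_ : _ - _ = w ^+ 4 * X); last by rewrite /bump /= !addnS !addn0; ring.
rewrite normrM normrX mulrC ler_wpM2r ?exprn_ge0 //.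
have -> : (16 * M)%:C%C = M%:C%C * 2 * 8 :> C by rewrite rmorphM rmorph_nat; ring.
apply: contour_le => z zb; rewrite normrM ler_pM ?fM //.
rewrite normrM normrX normfV -[2]mul1r ler_pM ?exprn_ge0 ?invr_ge0 ?normr_ge0 //.
  rewrite exprn_ile1 ?invr_ge0 // invf_le1 ?on_boundary_ge1 //.
  exact: lt_le_trans (on_boundary_ge1 zb).
rewrite normfV -[2]invrK lef_pV2 ?posrE ?invr_gt0 ?on_boundary_dist //.
by rewrite normr_gt0 (on_boundary_neq0 zb wb).
Qed.

(** Discrete form of Cauchy's integral for the [j]-th Taylor coefficient at 0. *)
Definition taylor_sum (f : C -> C) (j k : nat) : C :=
  contour (fun z => f z * z^-1 ^+ j.+1) k / winding k.

Lemma taylor_sum_le f j k (M : R) :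
  (forall z : C, on_boundary corner 2 z -> `|f z| <= M%:C%C) ->
  `|taylor_sum f j k| <= (2 * M)%:C%C.
Proof.
move=> fM; rewrite /taylor_sum normrM normfV ler_pdivrMr; last first.
  by rewrite (lt_le_trans _ (winding_ge R k)).
have M0 : 0 <= (M%:C%C : C).
  apply: le_trans (normr_ge0 (f corner)) (fM corner _).
  split; [split; rewrite lexx /= lerDl //|exact: Or41].
have -> : (2 * M)%:C%C = M%:C%C * 2 :> C by rewrite rmorphM rmorph_nat mulrC.
apply: (@le_trans _ _ (M%:C%C * 8)).
  apply: contour_le => z zb; rewrite normrM -[leRHS]mulr1 ler_pM ?fM //.
  rewrite normrX normfV exprn_ile1 ?invr_ge0 //.
  by rewrite invf_le1 ?on_boundary_ge1 // (lt_le_trans _ (on_boundary_ge1 zb)).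
rewrite -mulrA ler_wpM2l //; have -> : 8 = 2 * 4 :> C by rewrite -natrM.
by rewrite ler_wpM2l // winding_ge.
Qed.

Lemma taylor_sum_lin f g (c : C) j k :
  taylor_sum (fun z => f z + c * g z) j k = taylor_sum f j k + c * taylor_sum g j k.
Proof.
rewrite /taylor_sum mulrA -mulrDl -contour_lin; congr (_ / _).
by apply: contour_eq => z _; ring.
Qed.

(** The contour sum of [1 / (z - w)] differs from [winding k] by [O(|w| ^+ 4)],
    since the intermediate powers of [1 / z] have contour sum 0.  Dividing Cauchy's
    formula by [winding k] thus preserves the expansion to this order. *)
Lemma taylor_sum_approx (f : C -> C) (M : R) (w : C) :
  (forall z : C, in_square corner 2 z -> differentiable f z /\ `|f z| <= M%:C%C) ->
  `|w| <= 2^-1 -> forall e : R, 0 < e -> exists K, forall k, (K <= k)%N ->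
  `|f w - \sum_(j < 4) w ^+ j * taylor_sum f j k| <= (8 * M)%:C%C * `|w| ^+ 4 + e%:C%C.
Proof.
move=> fM wb e e0.
have [K KP] := cauchy_formula (fun z zq => (fM z zq).1) wb e0.
exists K => k /KP cw.
have wsq : in_square corner 2 w.
  by apply: in_square_small; rewrite (le_trans wb) // invf_le1 // ler1n.
have h1 := @kernel_expand f w M k (fun z zb => (fM z zb.1).2) wb.
have h2 := @kernel_expand (fun=> 1) w 1 k _ wb.
have {}h2 : `|contour (fun z : C => (z - w)^-1) k - winding k| <= (16 * 1)%:C%C * `|w| ^+ 4.
  have := h2 _; rewrite !big_ord_recl big_ord0 /= /bump /= !addnS !addn0.
  have E n : contour (fun z : C => 1 * z^-1 ^+ n) k = contour (fun z : C => z^-1 ^+ n) k.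
    by congr contour; apply/funext => z; rewrite mul1r.
  rewrite !E (@contour_inv_pow R 1) // (@contour_inv_pow R 2) //.
  rewrite (@contour_inv_pow R 3) // !mulr0 !addr0 mul1r.
  have -> : contour (fun z : C => z^-1 ^+ 1) k = winding k.
    by congr contour; apply/funext => z; rewrite expr1.
  have -> : contour (fun z : C => 1 * (z - w)^-1) k = contour (fun z : C => (z - w)^-1) k.
    by congr contour; apply/funext => z; rewrite mul1r.
  by apply=> z _; rewrite normr1.
have c4 := winding_ge R k; set c := winding k in h2 c4 *.
have c0 : c != 0 by rewrite -normr_gt0 (lt_le_trans _ c4).
set X := contour (fun z : C => f z * (z - w)^-1) k in cw h1.
set W := contour (fun z : C => (z - w)^-1) k in cw h2.
set S := \sum_(j < 4) _ in h1.
have -> : \sum_(j < 4) w ^+ j * taylor_sum f j k = S / c.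
  by rewrite /S mulr_suml; apply: eq_bigr => j _; rewrite mulrA.
have -> : f w - S / c = ((X - S) - (X - f w * W) - f w * (W - c)) / c by field.
rewrite normrM normfV ler_pdivrMr ?normr_gt0 //.
have fw := (fM w wsq).2.
have M0 : 0 <= (M%:C%C : C) by apply: le_trans fw.
have h3 : `|f w * (W - c)| <= M%:C%C * ((16 * 1)%:C%C * `|w| ^+ 4).
  by rewrite normrM ler_pM.
have B0 : 0 <= (8 * M)%:C%C * `|w| ^+ 4 + e%:C%C.
  by rewrite addr_ge0 // ?mulr_ge0 ?exprn_ge0 // ?rmorphM ?mulr_ge0 // ?rmorph_nat // ler0c ltW.
apply: le_trans (ler_wpM2l B0 c4).
apply: le_trans (ler_normB _ _) _; apply: le_trans (lerD (ler_normB _ _) (lexx _)) _.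
apply: le_trans (lerD (lerD h1 cw) h3) _.
rewrite !rmorphM /= !rmorph_nat rmorph1.
have -> : (8 * M%:C%C * `|w| ^+ 4 + e%:C%C) * 4 =
  16 * M%:C%C * `|w| ^+ 4 + e%:C%C + M%:C%C * (16 * 1 * `|w| ^+ 4) + 3 * e%:C%C :> C by ring.
by rewrite lerDl mulr_ge0 // ler0c ltW.
Qed.

(** The coefficients are defined for all functions that are bounded on the contour,
    holomorphic or not.  This is what allows the expansion of functions of two
    variables, whose coefficients in one variable are functions of the other. *)
Theorem taylor_functional : exists T : nat -> (C -> C) -> C,
  [/\ forall j f g (c : C) (M N : R),
         (forall z : C, on_boundary corner 2 z -> `|f z| <= M%:C%C) ->
         (forall z : C, on_boundary corner 2 z -> `|g z| <= N%:C%C) ->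
         T j (fun z => f z + c * g z) = T j f + c * T j g,
      forall j f (M : R), (forall z : C, on_boundary corner 2 z -> `|f z| <= M%:C%C) ->
         `|T j f| <= (2 * M)%:C%C &
      forall (f : C -> C) (M : R),
        (forall z : C, in_square corner 2 z -> differentiable f z /\ `|f z| <= M%:C%C) ->
        forall w, `|w| <= 2^-1 ->
        `|f w - \sum_(j < 4) w ^+ j * T j f| <= (8 * M)%:C%C * `|w| ^+ 4].
Proof.
have [L [Lc Llin Lle]] := ultralimit R.
have bd f j (M : R) : (forall z : C, on_boundary corner 2 z -> `|f z| <= M%:C%C) ->
    ubounded (taylor_sum f j).
  by move=> fM; exists (2 * M) => k; exact: taylor_sum_le.
exists (fun j f => L (taylor_sum f j)); split.
- move=> j f g c M N /bd fM /bd gN; rewrite -Llin //; congr L.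
  by apply/funext => k; rewrite taylor_sum_lin.
- move=> j f M fM; apply: Lle; first exact: bd fM.
  by exists 0%N => k _; exact: taylor_sum_le.
- move=> f M fM w wb.
  have fb (z : C) : on_boundary corner 2 z -> `|f z| <= M%:C%C by move=> [/fM[]].
  have b j := bd f j M fb.
  have bl u v (c : C) : ubounded u -> ubounded v -> ubounded (fun n => u n + c * v n).
    move=> [A uA] [B vB]; have [r rE] : exists r : R, `|c| = r%:C%C.
      by rewrite normc_def; eexists.
    exists (A + r * B) => n; rewrite (le_trans (ler_normD _ _)) // rmorphD rmorphM /=.
    by rewrite lerD // normrM rE ler_wpM2l // -rE.
  have bc (c : C) : ubounded (fun=> c).
    by rewrite /ubounded normc_def; eexists => _; exact: lexx.
  have B0 := bl _ _ (- w ^+ 0) (bc (f w)) (b 0).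
  have B1 := bl _ _ (- w ^+ 1) B0 (b 1).
  have B2 := bl _ _ (- w ^+ 2) B1 (b 2).
  have -> : f w - \sum_(j < 4) w ^+ j * L (taylor_sum f j) =
      L (fun k => f w - \sum_(j < 4) w ^+ j * taylor_sum f j k).
    rewrite !big_ord_recl big_ord0 /=.
    transitivity (L (fun k => f w + (- w ^+ 0) * taylor_sum f 0 k + (- w ^+ 1) * taylor_sum f 1 k
       + (- w ^+ 2) * taylor_sum f 2 k + (- w ^+ 3) * taylor_sum f 3 k)).
      rewrite (Llin _ _ _ B2 (b 3)) (Llin _ _ _ B1 (b 2)) (Llin _ _ _ B0 (b 1)).
      by rewrite (Llin _ _ _ (bc (f w)) (b 0)) Lc /bump /=; ring.
    congr L; apply/funext => k; rewrite !big_ord_recl big_ord0 /bump /=; ring.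
  apply/ler_addgt0Pr => _ /gt0_realC[e e0 ->].
  have [r rE] : exists r : R, (8 * M)%:C%C * `|w| ^+ 4 = r%:C%C.
    by rewrite normc_def -rmorphXn -rmorphM; eexists.
  rewrite rE -rmorphD; apply: Lle.
    have -> : (fun k => f w - \sum_(j < 4) w ^+ j * taylor_sum f j k) =
       (fun k => f w + (- w ^+ 0) * taylor_sum f 0 k + (- w ^+ 1) * taylor_sum f 1 k
       + (- w ^+ 2) * taylor_sum f 2 k + (- w ^+ 3) * taylor_sum f 3 k).
      by apply/funext => k; rewrite !big_ord_recl big_ord0 /bump /=; ring.
    exact: (bl _ _ (- w ^+ 3) B2 (b 3)).
  by have := taylor_sum_approx fM wb e0; rewrite rE -rmorphD.
Qed.

End Taylor.

(** * Taylor expansion in two variables *)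

Section TwoVariables.
Variable R : realType.
Local Notation C := (CC R).
Local Notation Re := (@complex.Re R).
Local Notation Im := (@complex.Im R).

(** Expand in [y] with coefficients [b k x] and a remainder [r x] of size
    [O(|y| ^+ 4)], then apply the coefficient functionals in [x]: they are linear,
    and bounded on bounded functions, in particular on [b k] and [r]. *)
Lemma taylor_bidisc (f : C -> C -> C) (M : R) :
  (forall x y : C, in_square corner 2 x -> in_square corner 2 y ->
    [/\ differentiable (f^~ y) x, differentiable (f x) y & `|f x y| <= M%:C%C]) ->
  exists c : nat -> nat -> C, forall x y : C, `|x| <= 2^-1 -> `|y| <= 2^-1 ->
    `|f x y - \sum_(j < 4) \sum_(k < 4) c j k * x ^+ j * y ^+ k| <=
    (64 * M)%:C%C * (`|x| ^+ 4 + `|y| ^+ 4).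
Proof.
move=> fP; have [T [Tlin Tle Ttay]] := taylor_functional R.
pose b k (x : C) := T k (f x).
exists (fun j k => T j (b k)) => x y xb yb.
have sq (z : C) : `|z| <= 2^-1 -> in_square corner 2 z.
  by move=> zb; apply: in_square_small; rewrite (le_trans zb) // invf_le1 // ler1n.
have bM k (z : C) : on_boundary corner 2 z -> `|b k z| <= (2 * M)%:C%C.
  move=> [zq _]; apply: Tle => z' [zq' _].
  by have [] := fP z z' zq zq'.
pose r (z : C) := f z y - \sum_(k < 4) y ^+ k * b k z.
have rM (z : C) : in_square corner 2 z -> `|r z| <= (8 * M)%:C%C * `|y| ^+ 4.
  move=> zq; apply: Ttay => // z' zq'.
  by have [] := fP z z' zq zq'.
have [q qE] : exists q : R, (8 * M)%:C%C * `|y| ^+ 4 = q%:C%C.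
  by rewrite normc_def -rmorphXn -rmorphM; eexists.
have rq (z : C) : on_boundary corner 2 z -> `|r z| <= q%:C%C by move=> [zq _]; rewrite -qE rM.
have bl (u v : C -> C) (c : C) :
    (exists A : R, forall z : C, on_boundary corner 2 z -> `|u z| <= A%:C%C) ->
    (exists A : R, forall z : C, on_boundary corner 2 z -> `|v z| <= A%:C%C) ->
    exists A : R, forall z : C, on_boundary corner 2 z -> `|u z + c * v z| <= A%:C%C.
  move=> [A uA] [B vB]; have [s sE] : exists s : R, `|c| = s%:C%C.
    by rewrite normc_def; eexists.
  exists (A + s * B) => z zb; rewrite (le_trans (ler_normD _ _)) // rmorphD rmorphM /=.
  by rewrite lerD ?uA // normrM sE ler_wpM2l ?vB // -sE.
have bb k : exists A : R, forall z : C, on_boundary corner 2 z -> `|b k z| <= A%:C%C.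
  by exists (2 * M); exact: bM.
have rr : exists A : R, forall z : C, on_boundary corner 2 z -> `|r z| <= A%:C%C by exists q.
have Tl j u v c : (exists A : R, forall z : C, on_boundary corner 2 z -> `|u z| <= A%:C%C) ->
    (exists A : R, forall z : C, on_boundary corner 2 z -> `|v z| <= A%:C%C) ->
    T j (fun z => u z + c * v z) = T j u + c * T j v.
  by move=> [A uA] [B vB]; exact: Tlin uA vB.
have B0 := bl _ _ (y ^+ 0) rr (bb 0%N).
have B1 := bl _ _ (y ^+ 1) B0 (bb 1%N).
have B2 := bl _ _ (y ^+ 2) B1 (bb 2%N).
have TE j : T j (f^~ y) = T j r + \sum_(k < 4) y ^+ k * T j (b k).
  transitivity (T j (fun z => r z + y ^+ 0 * b 0%N z + y ^+ 1 * b 1%N z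
       + y ^+ 2 * b 2%N z + y ^+ 3 * b 3%N z)).
    by congr (T j); apply/funext => z; rewrite /r !big_ord_recl big_ord0 /bump /=; ring.
  rewrite (Tl _ _ _ _ B2 (bb 3%N)) (Tl _ _ _ _ B1 (bb 2%N)) (Tl _ _ _ _ B0 (bb 1%N)).
  by rewrite (Tl _ _ _ _ rr (bb 0%N)) !big_ord_recl big_ord0 /bump /=; ring.
have yq := sq y yb.
have h1 : `|f x y - \sum_(j < 4) x ^+ j * T j (f^~ y)| <= (8 * M)%:C%C * `|x| ^+ 4.
  apply: (Ttay (f^~ y) M _ x xb) => z zq; have [d1 _ d3] := fP z y zq yq.
  by split; [exact: d1|exact: d3].
have -> : f x y - \sum_(j < 4) \sum_(k < 4) T j (b k) * x ^+ j * y ^+ k =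
  (f x y - \sum_(j < 4) x ^+ j * T j (f^~ y)) + \sum_(j < 4) x ^+ j * T j r.
  rewrite -addrA; congr (_ + _); apply/eqP; rewrite -subr_eq0; apply/eqP.
  rewrite !big_ord_recl !big_ord0 !TE !big_ord_recl !big_ord0; ring.
have M0 : 0 <= M.
  by rewrite -ler0c; have [_ _] := fP _ _ (sq x xb) yq; exact: le_trans.
have h2 : `|\sum_(j < 4) x ^+ j * T j r| <= (64 * M)%:C%C * `|y| ^+ 4.
  apply: le_trans (ler_norm_sum _ _ _) _.
  have -> : (64 * M)%:C%C * `|y| ^+ 4 = \sum_(j < 4) (1 * (2 * q)%:C%C).
    rewrite sumr_const card_ord -[RHS]mulr_natl (rmorphM _ 2 q) /= -qE.
    by rewrite !rmorphM !rmorph_nat; ring.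
  apply: ler_sum => j _; rewrite normrM ler_pM //.
    by rewrite normrX exprn_ile1 // (le_trans xb) // invf_le1 // ler1n.
  exact: (Tle _ _ _ rq).
rewrite mulrDr; apply: le_trans (ler_normD _ _) _; apply: lerD h2.
apply: le_trans h1 _; rewrite ler_wpM2r ?exprn_ge0 // lecR ler_wpM2r // ler_nat //.
Qed.

(** Only the terms of total degree at most 3 are determined by [f]. *)
Definition bijet (f : C * C -> C) (c : nat -> nat -> C) := exists K : C,
  \forall p \near (0 : C * C),
    `|f p - \sum_(j < 4) \sum_(k < 4) c j k * p.1 ^+ j * p.2 ^+ k| <=
    K * (`|p.1| ^+ 4 + `|p.2| ^+ 4).

(** Near the origin [f] is bounded and separately holomorphic, so after rescaling
    the expansion on the unit bidisc applies. *)
Theorem bijet_exists (f : C * C -> C) :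
  (\forall p \near (0 : C * C), differentiable f p) -> exists c, bijet f c.
Proof.
move=> fd.
have f0 : differentiable f 0 by exact: nbhs_singleton fd.
have fc := differentiable_continuous f0.
have fb : \forall p \near (0 : C * C), `|f 0 - f p| < 1.
  by have /cvgrPdist_lt/(_ 1 ltr01) := fc.
have [_ /gt0_realC[d d0 ->] dP] := (nbhs_ballP _ _).1 (filterI fd fb).
pose s : C := (d / 3)%:C%C.
have s0 : 0 < s by rewrite ltcR divr_gt0.
have bnd (z : C) : in_square corner 2 z -> `|z| <= 2.
  case: z => a b [/= h1 h2]; apply: le_trans (normc_le _) _.
  rewrite -(rmorph_nat (real_complex R)) lecR /=.
  have hx : `|a| <= 1 by rewrite ler_norml; lra.
  have hy : `|b| <= 1 by rewrite ler_norml; lra.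
  lra.
have inb (z : C) : in_square corner 2 z -> ball (0 : C) d%:C%C (s * z).
  move=> /bnd z2; rewrite /ball /= sub0r normrN normrM gtr0_norm //.
  have -> : d%:C%C = s * 3 :> C by rewrite /s rmorphM fmorphV rmorph_nat divfK.
  by rewrite ltr_pM2l // (le_lt_trans z2) // ltr_nat.
have inP (x y : C) : in_square corner 2 x -> in_square corner 2 y ->
    differentiable f (s * x, s * y) /\ `|f 0 - f (s * x, s * y)| < 1.
  by move=> xq yq; apply: dP; split; exact: inb.
have lin (z : C) : differentiable (fun z : C => s * z) z.
  by apply: differentiableM; [exact: differentiable_cst|exact: ex_diff].
have [m mE] : exists m : R, 1 + `|f 0| = m%:C%C.
  by rewrite normc_def; exists (1 + Num.sqrt (Re (f 0) ^+ 2 + Im (f 0) ^+ 2)); rewrite rmorphD rmorph1.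
have [|c cP] := @taylor_bidisc (fun x y => f (s * x, s * y)) m.
  move=> x y xq yq; have [fxy fb1] := inP x y xq yq; split.
  - by apply: (@differentiable_comp _ _ _ _ (fun x : C => (s * x, s * y)) f).
  - by apply: (@differentiable_comp _ _ _ _ (fun y : C => (s * x, s * y)) f).
  - rewrite -mE -[f _](subrK (f 0)) (le_trans (ler_normD _ _)) // lerD // distrC ltW //.
exists (fun j k => c j k * s^-1 ^+ (j + k)), ((64 * m)%:C%C * s^-1 ^+ 4).
have sm : 0 < s / 2 by rewrite divr_gt0.
apply/nbhs_ballP; exists (s / 2) => // -[x y] [].
rewrite /ball /= !sub0r !normrN => xs ys.
have sc (z : C) : `|z| < s / 2 -> `|s^-1 * z| <= 2^-1.
  by move=> zs; rewrite normrM normfV (gtr0_norm s0) ler_pdivrMl // ltW.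
have := cP _ _ (sc x xs) (sc y ys).
have sn : s != 0 by rewrite gt_eqF.
rewrite !mulVKf //; congr (`|_ - _| <= _).
  apply: eq_bigr => j _; apply: eq_bigr => k _.
  by rewrite !exprMn exprD; ring.
by rewrite !normrM !exprMn (@gtr0_norm _ s^-1) ?invr_gt0 //; ring.
Qed.

End TwoVariables.

(** * Jets of order three in one variable *)

Section LocallyBounded.
Variable R : realType.
Local Notation C := (CC R).

(** Landau's [O(1)] at 0. *)
Definition loc_bounded (r : C -> C) := exists K : C, \forall t \near (0 : C), `|r t| <= K.

Lemma loc_bounded_cst c : loc_bounded (fun=> c).
Proof. by exists `|c|; near=> t. Unshelve. all: by end_near. Qed.

Lemma loc_bounded_id : loc_bounded id.
Proof.
exists 1; apply/nbhs_ballP; exists 1; first exact: ltr01.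
by move=> t; rewrite /ball /= sub0r normrN => /ltW.
Qed.

Lemma loc_boundedD r s : loc_bounded r -> loc_bounded s -> loc_bounded (fun t => r t + s t).
Proof.
move=> [K rK] [L sL]; exists (K + L); apply: filterS2 rK sL => t rt st.
by rewrite (le_trans (ler_normD _ _)) // lerD.
Qed.

Lemma loc_boundedM r s : loc_bounded r -> loc_bounded s -> loc_bounded (fun t => r t * s t).
Proof.
move=> [K rK] [L sL]; exists (K * L); apply: filterS2 rK sL => t rt st.
by rewrite normrM ler_pM.
Qed.

Lemma loc_boundedX r n : loc_bounded r -> loc_bounded (fun t => r t ^+ n).
Proof.
move=> rl; elim: n => [|n IH]; first by under eq_fun do rewrite expr0; exact: loc_bounded_cst.
by under eq_fun do rewrite exprS; exact: loc_boundedM.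
Qed.

Lemma loc_bounded_le r s : loc_bounded r ->
  (\forall t \near (0 : C), `|s t| <= `|r t|) -> loc_bounded s.
Proof.
by move=> [K rK] sr; exists K; apply: filterS2 rK sr => t rt st; exact: le_trans rt.
Qed.

End LocallyBounded.

Ltac solve_loc_bounded :=
  lazymatch goal with
  | |- loc_bounded (fun t => @?r t + @?s t) =>
      apply: (@loc_boundedD _ r s); solve_loc_bounded
  | |- loc_bounded (fun t => @?r t * @?s t) =>
      apply: (@loc_boundedM _ r s); solve_loc_bounded
  | |- loc_bounded (fun t => t) => exact: loc_bounded_id
  | |- _ => first [assumption | exact: loc_bounded_cst]
  end.

Section Jets.
Variable R : realType.
Local Notation C := (CC R).

(** The remainder is [r t * t ^+ 4] rather than a bound, so that the rules below
    reduce to ring identities. *)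
Definition jet3 (f : C -> C) (c0 c1 c2 c3 : C) := exists2 r : C -> C, loc_bounded r &
  \forall t \near (0 : C), f t = c0 + c1 * t + c2 * t ^+ 2 + c3 * t ^+ 3 + r t * t ^+ 4.

Lemma jet3_eq f c0 c1 c2 c3 d0 d1 d2 d3 : jet3 f c0 c1 c2 c3 ->
  c0 = d0 -> c1 = d1 -> c2 = d2 -> c3 = d3 -> jet3 f d0 d1 d2 d3.
Proof. by move=> + <- <- <- <-. Qed.

Lemma jet3_near f g c0 c1 c2 c3 : (\forall t \near (0 : C), f t = g t) ->
  jet3 f c0 c1 c2 c3 -> jet3 g c0 c1 c2 c3.
Proof. by move=> fg [r rl fr]; exists r => //; apply: filterS2 fg fr => t <-. Qed.

Lemma jet3_cst c : jet3 (fun=> c) c 0 0 0.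
Proof.
exists (fun=> 0); first exact: loc_bounded_cst.
by apply: filterE => t; rewrite !mul0r !addr0.
Qed.

Lemma jet3_id : jet3 id 0 1 0 0.
Proof.
exists (fun=> 0); first exact: loc_bounded_cst.
by apply: filterE => t; rewrite !mul0r !addr0 add0r mul1r.
Qed.

Lemma jet3D f g c0 c1 c2 c3 d0 d1 d2 d3 :
  jet3 f c0 c1 c2 c3 -> jet3 g d0 d1 d2 d3 ->
  jet3 (fun t => f t + g t) (c0 + d0) (c1 + d1) (c2 + d2) (c3 + d3).
Proof.
move=> [r rl fr] [s sl gs]; exists (fun t => r t + s t); first exact: loc_boundedD.
by apply: filterS2 fr gs => t -> ->; ring.
Qed.

Lemma jet3M f g c0 c1 c2 c3 d0 d1 d2 d3 :
  jet3 f c0 c1 c2 c3 -> jet3 g d0 d1 d2 d3 ->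
  jet3 (fun t => f t * g t) (c0 * d0) (c0 * d1 + c1 * d0)
    (c0 * d2 + c1 * d1 + c2 * d0) (c0 * d3 + c1 * d2 + c2 * d1 + c3 * d0).
Proof.
move=> [r rl fr] [s sl gs].
exists (fun t => c1 * d3 + c2 * d2 + c3 * d1 + (c2 * d3 + c3 * d2) * t + c3 * d3 * (t * t)
  + r t * (d0 + d1 * t + d2 * (t * t) + d3 * (t * (t * t)))
  + s t * (c0 + c1 * t + c2 * (t * t) + c3 * (t * (t * t)))
  + r t * s t * (t * (t * (t * t)))).
  by solve_loc_bounded.
by apply: filterS2 fr gs => t -> ->; ring.
Qed.

Lemma loc_bounded_eq0 (e : C) r : loc_bounded r ->
  (\forall t \near (0 : C), t != 0 -> e = r t * t) -> e = 0.
Proof.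
move=> [K rK] er; have [_ /gt0_realC[d d0 ->] dP] := (nbhs_ballP _ _).1 (filterI rK er).
have bd (x : R) : 0 < x < d -> `|e| <= K * x%:C%C.
  move=> /andP[x0 xd]; have [|rx ex] := dP x%:C%C.
    by rewrite /ball /= sub0r normrN gtr0_norm ltcR.
  have xC : 0 < x%:C%C :> C by rewrite ltcR.
  rewrite (ex (lt0r_neq0 xC)) normrM (gtr0_norm xC).
  by apply: ler_wpM2r rx; exact: ltW.
have K0 : 0 <= K.
  by have [|r0 _] := dP 0; [apply: ballxx; rewrite ltcR|exact: le_trans (normr_ge0 _) r0].
apply/eqP; rewrite -normr_le0; apply/ler_addgt0Pr => _ /gt0_realC[x x0 ->].
rewrite add0r.
have [k kE] : exists k : R, K + 1 = k%:C%C.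
  by have /gt0_realC[k _ ->] : 0 < K + 1 by [rewrite ltr_wpDl]; exists k.
have k0 : 0 < k by rewrite -ltcR -kE ltr_wpDl.
pose y := Num.min (d / 2) (x / k).
have y0 : 0 < y by rewrite lt_min !divr_gt0.
have yd : y < d by rewrite /y gt_min; apply/orP; left; lra.
apply: le_trans (bd y _) _; first by rewrite y0.
apply: (@le_trans _ _ (k%:C%C * y%:C%C)).
  by rewrite -kE ler_wpM2r ?ler0c ?ltW // ltrDl.
rewrite -rmorphM lecR mulrC -ler_pdivlMr // ge_min lexx orbT //.
Qed.

Lemma jet3_eq0 c0 c1 c2 c3 : jet3 (fun=> 0) c0 c1 c2 c3 ->
  [/\ c0 = 0, c1 = 0, c2 = 0 & c3 = 0].
Proof.
move=> [r rl fr].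
have z0 : c0 = 0.
  by have /esym := nbhs_singleton fr; rewrite !expr0n /= !mulr0 !addr0.
have step (c : C) (s : C -> C) : loc_bounded s ->
    (\forall t \near (0 : C), t != 0 -> 0 = c + s t * t) -> c = 0.
  move=> sl h; apply: (@loc_bounded_eq0 _ (fun t => - 1 * s t)).
    by apply: loc_boundedM => //; exact: loc_bounded_cst.
  by apply: filterS h => t h /h e; rewrite -[LHS]subr0 e; ring.
have z1 : c1 = 0.
  apply: (step _ (fun t => c2 + c3 * t + r t * (t * t))).
    by solve_loc_bounded.
  apply: filterS fr => t; rewrite z0 add0r => e t0; apply: (mulfI t0).
  by rewrite mulr0 e; ring.
have z2 : c2 = 0.
  apply: (step _ (fun t => c3 + r t * t)).
    by solve_loc_bounded.
  apply: filterS fr => t; rewrite z0 z1 mul0r !add0r => e t0; apply: (mulfI (expf_neq0 2 t0)).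
  by rewrite mulr0 e; ring.
split => //; apply: (step _ r) => //.
apply: filterS fr => t; rewrite z0 z1 z2 !mul0r !add0r => e t0; apply: (mulfI (expf_neq0 3 t0)).
by rewrite mulr0 e; ring.
Qed.

Lemma jet3_unique f c0 c1 c2 c3 d0 d1 d2 d3 :
  jet3 f c0 c1 c2 c3 -> jet3 f d0 d1 d2 d3 -> [/\ c0 = d0, c1 = d1, c2 = d2 & c3 = d3].
Proof.
move=> fc fd; have := jet3D fc (jet3M (jet3_cst (-1)) fd).
under eq_fun do rewrite mulN1r subrr.
move=> /jet3_eq0[]; rewrite !(mul0r, mulN1r, addr0, add0r).
by do 4 (move=> /eqP; rewrite subr_eq0 => /eqP ?).
Qed.

End Jets.

(** * Composition of expansions *)

Section JetComposition.
Variable R : realType.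
Local Notation C := (CC R).

Lemma jet3_small X x1 x2 x3 : jet3 X 0 x1 x2 x3 ->
  exists2 u : C -> C, loc_bounded u & \forall t \near (0 : C), X t = t * u t.
Proof.
move=> [r rl Xr]; exists (fun t => x1 + x2 * t + x3 * (t * t) + r t * (t * (t * t))).
  by solve_loc_bounded.
by apply: filterS Xr => t ->; ring.
Qed.

Lemma jet3_near0 X x1 x2 x3 e : jet3 X 0 x1 x2 x3 -> 0 < e ->
  \forall t \near (0 : C), `|X t| < e.
Proof.
move=> /jet3_small[u [K uK] Xu] e0.
have [_ /gt0_realC[d d0 ->] dP] := (nbhs_ballP _ _).1 (filterI uK Xu).
have K0 : 0 <= K.
  by have [|r0 _] := dP 0; [apply: ballxx; rewrite ltcR|exact: le_trans (normr_ge0 _) r0].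
have K1 : 0 < K + 1 by rewrite ltr_wpDl.
have b1 : \forall t \near (0 : C), `|t| < e / (K + 1).
  apply/nbhs_ballP; exists (e / (K + 1)); first exact: divr_gt0.
  by move=> t; rewrite /ball /= sub0r normrN.
apply: filterS3 uK Xu b1 => t ut -> tb.
have [->|t0] := eqVneq t 0; first by rewrite mul0r normr0.
rewrite normrM; apply: le_lt_trans (_ : `|t| * (K + 1) < e); last by rewrite -ltr_pdivlMr.
by rewrite ler_wpM2l // (le_trans ut) // lerDl.
Qed.

Lemma jet3_in X Y x1 x2 x3 y1 y2 y3 (P : C * C -> Prop) :
  jet3 X 0 x1 x2 x3 -> jet3 Y 0 y1 y2 y3 ->
  (\forall p \near (0 : C * C), P p) -> \forall t \near (0 : C), P (X t, Y t).
Proof.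
move=> JX JY /nbhs_ballP[e e0 eP].
apply: filterS2 (jet3_near0 JX e0) (jet3_near0 JY e0) => t Xt Yt.
by apply: eP; split; rewrite /ball /= sub0r normrN.
Qed.

(** The terms of degree at least 4 contribute to the remainder only, as [X] and [Y]
    vanish at 0. *)
Lemma jet3_comp (f : C * C -> C) c X Y x1 x2 x3 y1 y2 y3 : bijet f c ->
  jet3 X 0 x1 x2 x3 -> jet3 Y 0 y1 y2 y3 ->
  jet3 (fun t => f (X t, Y t)) (c 0%N 0%N) (c 1%N 0%N * x1 + c 0%N 1%N * y1)
    (c 1%N 0%N * x2 + c 0%N 1%N * y2 + c 2%N 0%N * x1 ^+ 2
     + c 1%N 1%N * x1 * y1 + c 0%N 2%N * y1 ^+ 2)
    (c 1%N 0%N * x3 + c 0%N 1%N * y3 + 2 * c 2%N 0%N * x1 * x2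
     + c 1%N 1%N * (x1 * y2 + x2 * y1)
     + 2 * c 0%N 2%N * y1 * y2 + c 3%N 0%N * x1 ^+ 3 + c 2%N 1%N * x1 ^+ 2 * y1
     + c 1%N 2%N * x1 * y1 ^+ 2 + c 0%N 3%N * y1 ^+ 3).
Proof.
move=> [K fK] JX JY.
pose S t := \sum_(j < 4) \sum_(k < 4) c j k * X t ^+ j * Y t ^+ k.
have JR : jet3 (fun t => f (X t, Y t) - S t) 0 0 0 0.
  exists (fun t => (f (X t, Y t) - S t) / t ^+ 4); last first.
    have K0 := nbhs_singleton (jet3_in JX JY fK).
    have [u _ Xu] := jet3_small JX; have [v _ Yv] := jet3_small JY.
    have X0 := nbhs_singleton Xu; have Y0 := nbhs_singleton Yv.
    apply: filterE => t; rewrite !mul0r !add0r.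
    have [->|t0] := eqVneq t 0; last by rewrite divfK // expf_neq0.
    suff -> : f (X 0, Y 0) - S 0 = 0 by rewrite mul0r mul0r.
    apply/eqP; rewrite -normr_le0; apply: le_trans K0 _.
    by rewrite /= X0 Y0 !mul0r normr0 expr0n /= addr0 mulr0.
  have [u ul Xu] := jet3_small JX; have [v vl Yv] := jet3_small JY.
  apply: (@loc_bounded_le R (fun t => K * (`|u t| ^+ 4 + `|v t| ^+ 4))).
    have nl w : loc_bounded w -> loc_bounded (fun t => `|w t| ^+ 4).
      move=> wl; apply: loc_boundedX; apply: loc_bounded_le wl _.
      by apply: filterE => t; rewrite normr_id.
    by apply: loc_boundedM; [exact: loc_bounded_cst|apply: loc_boundedD; exact: nl].
  apply: filterS3 (jet3_in JX JY fK) Xu Yv => t ft Xt Yt.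
  have [->|t0] := eqVneq t 0; first by rewrite expr0n /= invr0 mulr0 normr0.
  rewrite normrM normfV ler_pdivrMr ?normr_gt0 ?expf_neq0 //.
  have P0 := le_trans (normr_ge0 _) ft.
  apply: le_trans ft _; rewrite -(ger0_norm P0) /=.
  have -> : K * (`|X t| ^+ 4 + `|Y t| ^+ 4) = K * (`|u t| ^+ 4 + `|v t| ^+ 4) * `|t| ^+ 4.
    by rewrite Xt Yt !normrM !exprMn; ring.
  by rewrite normrM !normrX normr_id.
have JX0 : jet3 (fun t => X t ^+ 0) 1 0 0 0 by exact: jet3_cst.
have JY0 : jet3 (fun t => Y t ^+ 0) 1 0 0 0 by exact: jet3_cst.
have p2 (W : C -> C) (w1 w2 w3 : C) : jet3 W 0 w1 w2 w3 ->
    jet3 (fun t => W t ^+ 2) 0 0 (w1 ^+ 2) (2 * w1 * w2).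
  move=> JW; apply: (jet3_eq (jet3M JW JW)); ring.
have p3 (W : C -> C) (w1 w2 w3 : C) : jet3 W 0 w1 w2 w3 ->
    jet3 (fun t => W t ^+ 3) 0 0 0 (w1 ^+ 3).
  move=> JW; apply: (jet3_eq (jet3M JW (jet3M JW JW))); ring.
have JX2 := p2 _ _ _ _ JX; have JX3 := p3 _ _ _ _ JX.
have JY2 := p2 _ _ _ _ JY; have JY3 := p3 _ _ _ _ JY.
have Z j k (a0 a1 a2 a3 b0 b1 b2 b3 : C) : jet3 (fun t => X t ^+ j) a0 a1 a2 a3 ->
    jet3 (fun t => Y t ^+ k) b0 b1 b2 b3 -> jet3 (fun t => c j k * X t ^+ j * Y t ^+ k)
     (c j k * (a0 * b0)) (c j k * (a0 * b1 + a1 * b0))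
     (c j k * (a0 * b2 + a1 * b1 + a2 * b0))
     (c j k * (a0 * b3 + a1 * b2 + a2 * b1 + a3 * b0)).
  move=> Xj Yk; apply: (jet3_eq (jet3M (jet3M (jet3_cst (c j k)) Xj) Yk)); ring.
have JS j (a0 a1 a2 a3 : C) : jet3 (fun t => X t ^+ j) a0 a1 a2 a3 ->
   jet3 (fun t => \sum_(k < 4) c j k * X t ^+ j * Y t ^+ k) (c j 0%N * a0)
    (c j 0%N * a1 + c j 1%N * (a0 * y1))
    (c j 0%N * a2 + c j 1%N * (a0 * y2 + a1 * y1) + c j 2%N * (a0 * y1 ^+ 2))
    (c j 0%N * a3 + c j 1%N * (a0 * y3 + a1 * y2 + a2 * y1)
      + c j 2%N * (a0 * (2 * y1 * y2) + a1 * y1 ^+ 2) + c j 3%N * (a0 * y1 ^+ 3)).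
  move=> Xj; under eq_fun do rewrite !big_ord_recl big_ord0.
  have J0 := Z j 0%N _ _ _ _ _ _ _ _ Xj JY0; have J1 := Z j 1%N _ _ _ _ _ _ _ _ Xj JY.
  have J2 := Z j 2%N _ _ _ _ _ _ _ _ Xj JY2; have J3 := Z j 3%N _ _ _ _ _ _ _ _ Xj JY3.
  apply: (jet3_eq (jet3D J0 (jet3D J1 (jet3D J2 (jet3D J3 (jet3_cst 0)))))); ring.
have J0 := JS 0%N _ _ _ _ JX0; have J1 := JS 1%N _ _ _ _ JX.
have J2 := JS 2%N _ _ _ _ JX2; have J3 := JS 3%N _ _ _ _ JX3.
apply: (@jet3_near R (fun t => S t + (f (X t, Y t) - S t))).
  by apply: filterE => t; rewrite addrC subrK.
rewrite /S.
under eq_fun do rewrite {1}big_ord_recl 3!big_ord_recl big_ord0.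
apply: (jet3_eq (jet3D (jet3D J0 (jet3D J1 (jet3D J2 (jet3D J3 (jet3_cst 0))))) JR)); ring.
Qed.

End JetComposition.

(** * The expansions of the two maps and of their compositions *)

Section Commutator.
Variable R : realType.
Local Notation C := (CC R).

Lemma bijet_swap (f : C * C -> C) c : bijet f c ->
  bijet (fun p => f (p.2, p.1)) (fun j k => c k j).
Proof.
move=> [K /nbhs_ballP[e e0 eP]]; exists K; apply/nbhs_ballP; exists e => // -[x y] [xe ye].
have /= := eP (y, x) (conj ye xe); rewrite exchange_big addrC /=.
rewrite (addrC (`|y| ^+ 4)); congr (`|_| <= _); rewrite addrC; congr (_ - _).
by apply: eq_bigr => j _; apply: eq_bigr => k _; rewrite -!mulrA (mulrC (x ^+ _)).
Qed.

Lemma jet3_axis1 (f : C * C -> C) c : bijet f c ->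
  jet3 (fun t => f (t, 0)) (c 0%N 0%N) (c 1%N 0%N) (c 2%N 0%N) (c 3%N 0%N).
Proof.
by move=> fc; apply: (jet3_eq (jet3_comp fc (jet3_id R) (jet3_cst 0))); ring.
Qed.

Lemma jet3_axis2 (f : C * C -> C) c : bijet f c ->
  jet3 (fun t => f (0, t)) (c 0%N 0%N) (c 0%N 1%N) (c 0%N 2%N) (c 0%N 3%N).
Proof.
by move=> fc; apply: (jet3_eq (jet3_comp fc (jet3_cst 0) (jet3_id R))); ring.
Qed.

(** The properties of the map of the group element [((1, 1), (a, 0))] that are used:
    its values on the two axes, and a consequence of equivariance, namely that the
    product of the two components depends on [p.1 * p.2] only. *)
Definition shear_like (F1 F2 : C * C -> C) (a : C) : Prop :=
  [/\ \forall t \near (0 : C), F1 (t, 0) * (1 - a * t) = t /\ F2 (t, 0) = 0,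
      \forall t \near (0 : C), F1 (0, t) = 0 /\ F2 (0, t) = t &
      \forall p \near (0 : C * C), F1 p * F2 p = F1 (- p.1, - p.2) * F2 (- p.1, - p.2)].

(** The axes determine the coefficients of the pure powers.  On the line
    [y = m x] the product of the components is even, so its coefficient of degree 3,
    which is [m * (a + c 1 1 * m + d 1 1)], vanishes for every [m]. *)
Lemma shear_like_bijet (F1 F2 : C * C -> C) (a : C) c d :
  bijet F1 c -> bijet F2 d -> shear_like F1 F2 a ->
  [/\ [/\ c 0%N 0%N = 0, c 1%N 0%N = 1 & c 0%N 1%N = 0],
      [/\ c 2%N 0%N = a, c 1%N 1%N = 0 & c 0%N 2%N = 0],
      [/\ d 0%N 0%N = 0, d 1%N 0%N = 0 & d 0%N 1%N = 1] &
      [/\ d 2%N 0%N = 0, d 1%N 1%N = - a & d 0%N 2%N = 0]].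
Proof.
move=> Fc Fd [/near_andP[h1 h2] /near_andP[h3 h4] par].
have Jl : jet3 (fun t => 1 - a * t) 1 (- a) 0 0.
  apply: (@jet3_near R (fun t => 1 + - a * t)).
    by apply: filterE => t; rewrite mulNr.
  by apply: (jet3_eq (jet3D (jet3_cst 1) (jet3M (jet3_cst (- a)) (jet3_id R)))); ring.
have [c00 c10 c20 c30] : [/\ 0 = c 0%N 0%N, 1 = c 1%N 0%N - a * c 0%N 0%N,
    0 = c 2%N 0%N - a * c 1%N 0%N & 0 = c 3%N 0%N - a * c 2%N 0%N].
  apply: (jet3_unique (jet3_id R)).
  apply: (jet3_near h1); apply: (jet3_eq (jet3M (jet3_axis1 Fc) Jl)); ring.
have [d00 d10 d20 d30] := jet3_unique (jet3_near h2 (jet3_axis1 Fd)) (jet3_cst 0).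
have [_ c01 c02 c03] := jet3_unique (jet3_near h3 (jet3_axis2 Fc)) (jet3_cst 0).
have [_ d01 d02 d03] := jet3_unique (jet3_near h4 (jet3_axis2 Fd)) (jet3_id R).
have {}c20 : c 2%N 0%N = a.
  move/eqP: c20; rewrite eq_sym subr_eq0 => /eqP ->.
  by move: c10; rewrite -c00 mulr0 subr0 => <-; rewrite mulr1.
move: c10; rewrite -c00 mulr0 subr0 => /esym c10.
have par1 (m : C) : a * m + c 1%N 1%N * m ^+ 2 + d 1%N 1%N * m = 0.
  have JX : jet3 (fun t : C => t) 0 1 0 0 := jet3_id R.
  have JY : jet3 (fun t : C => m * t) 0 m 0 0.
    by apply: (jet3_eq (jet3M (jet3_cst m) (jet3_id R))); ring.
  have JXn : jet3 (fun t : C => -1 * t) 0 (-1) 0 0.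
    by apply: (jet3_eq (jet3M (jet3_cst (-1)) (jet3_id R))); ring.
  have JYn : jet3 (fun t : C => -1 * (m * t)) 0 (- m) 0 0.
    by apply: (jet3_eq (jet3M (jet3_cst (-1)) JY)); ring.
  have P := jet3M (jet3_comp Fc JX JY) (jet3_comp Fd JX JY).
  have Q := jet3M (jet3_comp Fc JXn JYn) (jet3_comp Fd JXn JYn).
  have PQ := jet3_in JX JY par.
  have {}PQ : \forall t \near (0 : C), F1 (t, m * t) * F2 (t, m * t) =
     F1 (-1 * t, -1 * (m * t)) * F2 (-1 * t, -1 * (m * t)).
    by apply: filterS PQ => t /=; rewrite !mulN1r.
  have [_ _ _] := jet3_unique (jet3_near PQ P) Q.
  rewrite -c00 c10 c20 c01 c02 d00 d10 d20 d01 d02 => e.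
  (* The coefficients of degree 3 in [t] are opposite, hence both vanish. *)
  have two : (2 : C) != 0 by rewrite pnatr_eq0.
  apply: (mulfI two); rewrite mulr0; move/eqP: e; rewrite -subr_eq0 => /eqP <-; ring.
have p1 := par1 1; have p2 := par1 2.
have c11 : c 1%N 1%N = 0.
  have two : (2 : C) != 0 by rewrite pnatr_eq0.
  apply: (mulfI two); rewrite mulr0.
  have -> : 2 * c 1%N 1%N = (a * 2 + c 1%N 1%N * 2 ^+ 2 + d 1%N 1%N * 2) -
    2 * (a * 1 + c 1%N 1%N * 1 ^+ 2 + d 1%N 1%N * 1) by ring.
  by rewrite p1 p2 mulr0 subr0.
split; split => //.
by apply/eqP; rewrite -addr_eq0; apply/eqP; move: p1; rewrite c11 => <-; ring.
Qed.

(** On the diagonal the first components of the two compositions have [t ^+ 3]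
    coefficients that differ by [2 * a * b]: the cubic coefficients of [F1] and [H1]
    enter both in the same way, and only products of quadratic terms remain.
    The hypothesis on [H] is the one on [F] with the coordinates exchanged. *)
Theorem no_commuting_shears (F1 F2 H1 H2 : C * C -> C) (a b : C) (c d e g : nat -> nat -> C) :
  bijet F1 c -> bijet F2 d -> bijet H1 e -> bijet H2 g ->
  shear_like F1 F2 a -> shear_like (fun p => H2 (p.2, p.1)) (fun p => H1 (p.2, p.1)) b ->
  (\forall p \near (0 : C * C), F1 (H1 p, H2 p) = H1 (F1 p, F2 p)) -> a * b = 0.
Proof.
move=> Fc Fd He Hg Fs Hs FH.
have [[c00 c10 c01] [c20 c11 c02] [d00 d10 d01] [d20 d11 d02]] := shear_like_bijet Fc Fd Fs.
have [[g00 g01 g10] [g02 g11 g20] [e00 e01 e10] [e02 e11 e20]] :=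
  shear_like_bijet (bijet_swap Hg) (bijet_swap He) Hs.
have JX : jet3 (fun t : C => t) 0 1 0 0 := jet3_id R.
have JF1 := jet3_comp Fc JX JX; have JF2 := jet3_comp Fd JX JX.
have JH1 := jet3_comp He JX JX; have JH2 := jet3_comp Hg JX JX.
rewrite c00 in JF1; rewrite d00 in JF2; rewrite e00 in JH1; rewrite g00 in JH2.
have L := jet3_comp Fc JH1 JH2; have M := jet3_comp He JF1 JF2.
have near_diag := jet3_in JX JX FH.
have [_ _ _ /eqP] := jet3_unique (jet3_near near_diag L) M.
rewrite c10 c01 c20 c11 c02 d10 d01 d20 d11 d02 e10 e01 e20 e11 e02 g10 g01 g20 g11 g02.
rewrite -subr_eq0 => /eqP E; have two : (2 : C) != 0 by rewrite pnatr_eq0.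
by apply: (mulfI two); rewrite mulr0 -oppr0 -[in RHS]E; ring.
Qed.

End Commutator.

(** * The total space as a graph, and admissible pairs of neighbourhoods *)

Section Geometry.
Variable R : realType.
Local Notation C := (CC R).

Lemma differentiable_fst (V W : normedModType R[i]) (p : V * W) :
  differentiable (fst : V * W -> V) p.
Proof.
apply: (@linear_differentiable _ _ _ ((@fst V W) : {linear (V * W)%type -> V}) p).
by move=> q; exact: cvg_fst.
Qed.

Lemma differentiable_snd (V W : normedModType R[i]) (p : V * W) :
  differentiable (snd : V * W -> W) p.
Proof.
apply: (@linear_differentiable _ _ _ ((@snd V W) : {linear (V * W)%type -> W}) p).
by move=> q; exact: cvg_snd.
Qed.

(** The chart of the total space: its hypersurface [xy = s] is a graph over the
    plane. *)
Definition graph (p : C * C) : (C * C) * C := (p, p.1 * p.2).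

Lemma differentiable_graph p : differentiable graph p.
Proof.
apply: differentiable_pair; first exact: ex_diff.
by apply: differentiableM; [exact: differentiable_fst|exact: differentiable_snd].
Qed.

Lemma graph0 : graph 0 = 0.
Proof. by rewrite /graph /= mulr0. Qed.

Lemma graph_near (P : (C * C) * C -> Prop) :
  (\forall q \near (0 : (C * C) * C), P q) -> \forall p \near (0 : C * C), P (graph p).
Proof.
move=> P0; have := differentiable_continuous (differentiable_graph 0).
by move/(_ P); apply; rewrite /= graph0.
Qed.

(** Cut [Y] by the interior of [K]: the closure stays in the compact set [K]. *)
Lemma nbhd_pair_exists (E : normedModType R[i]) (Y O K : set E) :
  closed Y -> Y 0 -> open O -> compact K -> K `<=` O -> nbhs 0 K ->
  exists U V, nbhd_pair (Y `&` O) U V.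
Proof.
move=> Ycl Y0 Oop Kc KO K0.
have Kcl : closed K by apply: compact_closed => //; exact: norm_hausdorff.
have UK : closure (Y `&` O `&` K°) `<=` Y `&` K.
  rewrite ((closure_id (Y `&` K)).1 (closedI Ycl Kcl)).
  by apply: closureS => y [[Yy _] /interior_subset].
exists (Y `&` O `&` K°), (Y `&` O); split.
- split; last by exists K° => //; exact: open_interior.
  by split=> //; split=> //; apply: KO; exact: nbhs_singleton.
- split; first by split=> //; apply: KO; exact: nbhs_singleton.
  by exists setT; [exact: openT|rewrite setIT].
- split; last by move=> x /UK[Yx /KO].
  apply: (subclosed_compact _ Kc); first exact: closed_closure.
  by move=> x /UK[].
Qed.

Lemma bsquare_le (M : R) (z : C) : bsquare M z -> `|z| <= (2 * M)%:C%C.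
Proof.
move=> [[x y] [/= hx hy] <-]; apply: le_trans (normc_le _) _; rewrite lecR.
have -> : ReIm (x, y) = (x +i* y)%C by rewrite /ReIm /=; simpc.
move: hx hy; rewrite /= !in_itv /= -!ler_norml => hx hy; lra.
Qed.

Lemma nbhs_bsquare (M : R) : 0 < M -> nbhs (0 : C) (bsquare M).
Proof.
move=> M0; apply/nbhs_ballP; exists M%:C%C; first by rewrite /= ltcR.
by move=> z; rewrite /ball /= sub0r normrN => /ltW; exact: bsquareP.
Qed.

Lemma nbhd_pair_line (O : set C) : open O -> O 0 -> exists U V, nbhd_pair ([set: C] `&` O) U V.
Proof.
move=> Oop O0; have /nbhs_ballP[_ /gt0_realC[d d0 ->] dO] : nbhs 0 O by exact: open_nbhs_nbhs.
have d3 : 0 < d / 3 by rewrite divr_gt0.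
apply: (@nbhd_pair_exists _ _ _ (bsquare (d / 3))) => //.
- exact: compact_bsquare.
- move=> z /bsquare_le zd; apply: dO; rewrite /ball /= sub0r normrN.
  by apply: le_lt_trans zd _; rewrite ltcR; lra.
- exact: nbhs_bsquare.
Qed.

Lemma totalX_closed : closed (@totalX R).
Proof.
have -> : @totalX R = (fun p : (C * C) * C => p.1.1 * p.1.2 - p.2) @^-1` [set 0].
  by apply/seteqP; split=> p; rewrite /totalX /= => h; [rewrite h subrr|apply/eqP; rewrite -subr_eq0 h].
apply: closed_comp => [p _|]; last first.
  by apply: accessible_closed_set1; apply: hausdorff_accessible; exact: norm_hausdorff.
apply: differentiable_continuous.
have d1 : differentiable (fun p : (C * C) * C => p.1.1) p.
  by apply: (@differentiable_comp _ _ _ _ fst fst); exact: differentiable_fst.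
have d2 : differentiable (fun p : (C * C) * C => p.1.2) p.
  by apply: (@differentiable_comp _ _ _ _ fst snd); [exact: differentiable_fst|exact: differentiable_snd].
by apply: differentiableB; [exact: differentiableM|exact: differentiable_snd].
Qed.

Lemma nbhd_pair_totalX (O : set ((C * C) * C)) : open O -> O 0 ->
  exists U V, nbhd_pair (@totalX R `&` O) U V.
Proof.
move=> Oop O0; have : nbhs (0 : (C * C) * C) O by exact: open_nbhs_nbhs.
move=> /nbhs_ballP[_ /gt0_realC[d d0 ->] dO].
have d3 : 0 < d / 3 by rewrite divr_gt0.
pose B := bsquare (d / 3).
have Bd (z : C) : B z -> ball (0 : C) d%:C%C z.
  move=> /bsquare_le zd; rewrite /ball /= sub0r normrN.
  by apply: le_lt_trans zd _; rewrite ltcR; lra.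
have B0 : nbhs (0 : C) B by exact: nbhs_bsquare.
apply: (@nbhd_pair_exists _ _ _ ((B `*` B) `*` B)) => //.
- exact: totalX_closed.
- by rewrite /totalX /= mulr0.
- by do 2 (apply: compact_setX; last exact: compact_bsquare); exact: compact_bsquare.
- by move=> [[x y] z] [[/= /Bd xd /Bd yd] /Bd zd]; apply: dO.
- by exists (B `*` B, B) => //; split=> //; exists (B, B).
Qed.

End Geometry.
Arguments graph {R} p.

(** * Maps of a local action in the coordinates of the plane *)

Section Action.
Variable R : realType.
Local Notation C := (CC R).

Implicit Types (A : local_action (@totalX R)) (g h : Gcoord R).

Lemma pair_graph A U V : la_pair A U V -> \forall p \near (0 : C * C), U (graph p).
Proof.
move=> [[U0 [W Wop UE]] _ _].
have W0 : nbhs (0 : (C * C) * C) (la_rep A `&` W).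
  apply: open_nbhs_nbhs; split; first by apply: openI => //; exact: la_rep_open.
  by move: U0; rewrite UE => -[[_ rA] WA].
by apply: filterS (graph_near W0) => p [Ap Wp]; rewrite UE.
Qed.

(** In the chart, a map of the action is given by its first two components, as its
    values lie in the total space. *)
Lemma local_model A U V g : la_pair A U V -> la_dom A U V g ->
  (\forall q \near (0 : C * C), nodeX q ->
     la_map A U V g (fibre0 q) = fibre0 (actX g q)) ->
  exists F1 F2 : C * C -> C,
  [/\ \forall p \near (0 : C * C), differentiable F1 p,
      \forall p \near (0 : C * C), differentiable F2 p,
      F1 0 = 0 /\ F2 0 = 0 &
      \forall p \near (0 : C * C), la_map A U V g (graph p) = graph (F1 p, F2 p)].
Proof.
move=> AUV Dg ext; have Un := pair_graph AUV.
have U0 := nbhs_singleton Un; rewrite graph0 in U0.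
have [hol UV] := la_hol AUV Dg; have [f [fd fE]] := hol 0 U0.
exists (fun p => (f (graph p)).1.1), (fun p => (f (graph p)).1.2).
have fgd : \forall p \near (0 : C * C), differentiable (f \o graph) p.
  by apply: filterS (graph_near fd) => p; apply: differentiable_comp; exact: differentiable_graph.
have E : \forall p \near (0 : C * C), la_map A U V g (graph p) =
    graph ((f (graph p)).1.1, (f (graph p)).1.2).
  apply: filterS2 Un (graph_near fE) => p Up /(_ Up) e; rewrite -e.
  have := UV _ Up; case: AUV => _ [_ [W _ ->]] _ [[+ _] _].
  by case: (la_map _ _ _ _ _) => -[x y] z; rewrite /totalX /graph /= => ->.
split => //.
- apply: filterS fgd => p fp.
  apply: (@differentiable_comp _ _ _ _ (fun p => (f (graph p)).1) fst); last exact: differentiable_fst.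
  by apply: (@differentiable_comp _ _ _ _ (f \o graph) fst) => //; exact: differentiable_fst.
- apply: filterS fgd => p fp.
  apply: (@differentiable_comp _ _ _ _ (fun p => (f (graph p)).1) snd); last exact: differentiable_snd.
  by apply: (@differentiable_comp _ _ _ _ (f \o graph) fst) => //; exact: differentiable_fst.
- have := nbhs_singleton E; rewrite graph0.
  have -> : 0 = fibre0 (0 : C * C) by [].
  rewrite (nbhs_singleton ext); last by rewrite /nodeX /= mulr0.
  by rewrite /fibre0 /actX /= !mulr0 !mul0r => -[<- <-].
Qed.

Lemma near_opp (P : C * C -> Prop) : (\forall p \near (0 : C * C), P p) ->
  \forall p \near (0 : C * C), P (- p.1, - p.2).
Proof.
move=> /nbhs_ballP[e e0 eP]; apply/nbhs_ballP; exists e => // -[x y] [xe ye].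
apply: eP; move: xe ye; rewrite /ball /= !sub0r !normrN => xe ye.
by split; rewrite /ball /= sub0r !normrN.
Qed.

Lemma near_pair (F1 F2 : C * C -> C) (P : C * C -> Prop) :
  differentiable F1 0 -> differentiable F2 0 -> F1 0 = 0 -> F2 0 = 0 ->
  (\forall p \near (0 : C * C), P p) -> \forall p \near (0 : C * C), P (F1 p, F2 p).
Proof.
move=> d1 d2 F10 F20 P0.
have := differentiable_continuous (differentiable_pair d1 d2).
by move/(_ P); apply; rewrite /= F10 F20.
Qed.

Lemma near_axes (P : C * C -> Prop) : (\forall p \near (0 : C * C), P p) ->
  \forall t \near (0 : C), P (t, 0) /\ P (0, t).
Proof.
move=> Pn.
exact: filterI (jet3_in (jet3_id R) (jet3_cst 0) Pn) (jet3_in (jet3_cst 0) (jet3_id R) Pn).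
Qed.

Lemma near_denom (s : C) : \forall t \near (0 : C), 1 - s * t != 0.
Proof.
have J : jet3 (fun t : C => s * t) 0 s 0 0.
  by apply: (jet3_eq (jet3M (jet3_cst s) (jet3_id R))); ring.
apply: filterS (jet3_near0 J ltr01) => t st.
by rewrite subr_eq0; apply: contraTneq st => <-; rewrite normr1 ltxx.
Qed.

(** The central fibre meets the chart in the two axes, where the action is given by
    [actX]. *)
Lemma model_axes A U V (s u : C) (F1 F2 : C * C -> C) :
  (\forall q \near (0 : C * C), nodeX q ->
     la_map A U V ((1, 1), (s, u)) (fibre0 q) = fibre0 (actX ((1, 1), (s, u)) q)) ->
  (\forall p \near (0 : C * C),
     la_map A U V ((1, 1), (s, u)) (graph p) = graph (F1 p, F2 p)) ->
  \forall t \near (0 : C), [/\ F1 (t, 0) * (1 - s * t) = t, F2 (t, 0) = 0,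
     F1 (0, t) = 0 & F2 (0, t) * (1 - u * t) = t].
Proof.
move=> /near_axes ext /near_axes mod.
have dn : \forall t \near (0 : C), 1 - s * t != 0 /\ 1 - u * t != 0.
  exact: filterI (near_denom s) (near_denom u).
apply: filterS3 ext mod dn => t [e1 e2] [m1 m2] [ds du].
have n1 : nodeX ((t, 0) : C * C) by rewrite /nodeX /= mulr0.
have n2 : nodeX ((0, t) : C * C) by rewrite /nodeX /= mul0r.
have g1 : graph ((t, 0) : C * C) = fibre0 (t, 0) by rewrite /graph /= mulr0.
have g2 : graph ((0, t) : C * C) = fibre0 (0, t) by rewrite /graph /= mul0r.
move: (e1 n1) (e2 n2); rewrite -g1 -g2 m1 m2 /fibre0 /actX /= !mul1r !mulr0 !mul0r.
by move=> [-> -> _] [-> -> _]; rewrite !divfK.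
Qed.

Lemma near_swap (P : C * C -> Prop) : (\forall p \near (0 : C * C), P p) ->
  \forall p \near (0 : C * C), P (p.2, p.1).
Proof.
move=> /nbhs_ballP[e e0 eP]; apply/nbhs_ballP; exists e => // -[x y] [xe ye].
by apply: eP; split.
Qed.

End Action.

Theorem claim7p4 (R : realType) :
  ~ exists (A : local_action (@totalX R)) (B : local_action [set: CC R]),
      extends_actX A /\ equivariant A B (@defpi R).
Proof.
move=> [A [B [ext equi]]].
have [U [V AUV]] := nbhd_pair_totalX (la_rep_open A) (la_rep0 A).
have [S [T BST]] := nbhd_pair_line (la_rep_open B) (la_rep0 B).
(* The two conditions hold on products of neighbourhoods of the identity and of the
   origin: from here on, group elements are fixed in the first factors. *)
have [[/= P1 Q1] [P1n Q1n] ext'] := ext _ _ AUV.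
have [[/= P2 Q2] [P2n Q2n] equi'] := equi _ _ _ _ AUV BST.
have [Dop _ D1] := la_dom_open AUV.
have Dn : nbhs (Gone R) (la_dom A U V) by exact: open_nbhs_nbhs.
have Nn : nbhs (Gone R) (P1 `&` P2 `&` la_dom A U V) by do 2 (apply: filterI => //).
move/nbhs_ballP: Nn => [_ /gt0_realC[e e0 ->] eP].
(* With this value of [a] the elements with parameters [(a, 0)], [(0, a)] and their
   product, in either order, with parameters [(a, a)], are all close to the identity. *)
pose a : CC R := (e / 2)%:C%C.
have a0 : a != 0 by rewrite gt_eqF // ltcR divr_gt0.
have inball (x y : CC R) : (x = 0 \/ x = a) -> (y = 0 \/ y = a) ->
    ball (Gone R) e%:C%C (((1, 1), (x, y)) : Gcoord R).
  have c1 : ball (1 : CC R) e%:C%C 1 by apply: ballxx; rewrite ltcR.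
  have c2 (z : CC R) : z = 0 \/ z = a -> ball (0 : CC R) e%:C%C z.
    case=> ->; first by apply: ballxx; rewrite ltcR.
    by rewrite /ball /= sub0r normrN gtr0_norm ltcR ?divr_gt0 //; lra.
  by move=> xa ya; split; split=> //=; exact: c2.
pose gp (x y : CC R) : Gcoord R := ((1, 1), (x, y)).
have model x y : (x = 0 \/ x = a) -> (y = 0 \/ y = a) ->
    la_dom A U V (gp x y) /\ exists F1 F2 : CC R * CC R -> CC R,
    [/\ \forall p \near (0 : CC R * CC R), differentiable F1 p,
        \forall p \near (0 : CC R * CC R), differentiable F2 p,
        F1 0 = 0 /\ F2 0 = 0,
        \forall p \near (0 : CC R * CC R), la_map A U V (gp x y) (graph p) = graph (F1 p, F2 p) &
        (\forall t \near (0 : CC R), [/\ F1 (t, 0) * (1 - x * t) = t, F2 (t, 0) = 0,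
           F1 (0, t) = 0 & F2 (0, t) * (1 - y * t) = t]) /\
        \forall p \near (0 : CC R * CC R),
          F1 p * F2 p = F1 (- p.1, - p.2) * F2 (- p.1, - p.2)].
  move=> xa ya; have [[P1g P2g] Dg] := eP _ (inball x y xa ya); split=> //.
  have extg : \forall q \near (0 : CC R * CC R), nodeX q ->
      la_map A U V (gp x y) (fibre0 q) = fibre0 (actX (gp x y) q).
    by apply: filterS Q1n => q Qq; exact: (ext' (gp x y, q) (conj P1g Qq)).
  have [F1 [F2 [F1d F2d F0 FE]]] := local_model AUV Dg extg.
  exists F1, F2; split => //; split; first exact: model_axes extg FE.
  (* By equivariance the product of the components is a function of [p.1 * p.2], which
     [p] and its opposite share. *)
  have prod_s : \forall p \near (0 : CC R * CC R),
      F1 p * F2 p = la_map B S T (gp x y) (p.1 * p.2).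
    apply: filterS2 FE (graph_near Q2n) => p pE Qp.
    by have := equi' (gp x y, graph p) (conj P2g Qp) erefl; rewrite /= pE.
  by apply: filterS2 prod_s (near_opp prod_s) => p -> ->; rewrite /= mulrNN.
have [Dg [F1 [F2 [F1d F2d [F10 F20] FE [Fax Fpar]]]]] :=
  model a 0 (or_intror erefl) (or_introl erefl).
have [Dh [H1 [H2 [H1d H2d [H10 H20] HE [Hax Hpar]]]]] :=
  model 0 a (or_introl erefl) (or_intror erefl).
have [Dgh _] := model a a (or_intror erefl) (or_intror erefl).
have Fs : shear_like F1 F2 a.
  split=> //; first by apply: filterS Fax => t [].
  by apply: filterS Fax => t [_ _ ->]; rewrite mul0r subr0 mulr1.
have Hs : shear_like (fun p => H2 (p.2, p.1)) (fun p => H1 (p.2, p.1)) a.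
  split; last by apply: filterS (near_swap Hpar) => p /=; rewrite mulrC => ->; rewrite mulrC.
    by apply: filterS Hax => t [].
  by apply: filterS Hax => t [+ -> _ _]; rewrite mul0r subr0 mulr1.
have [c cF1] := bijet_exists F1d; have [d dF2] := bijet_exists F2d.
have [c' cH1] := bijet_exists H1d; have [d' dH2] := bijet_exists H2d.
have Un := pair_graph AUV.
have n0 := @nbhs_singleton _ (0 : CC R * CC R).
have FH : \forall p \near (0 : CC R * CC R), la_map A U V (gp a a) (graph p) =
    graph (F1 (H1 p, H2 p), F2 (H1 p, H2 p)).
  have nH := @near_pair R H1 H2 _ (n0 _ H1d) (n0 _ H2d) H10 H20.
  apply: filterS3 (filterI Un HE) (nH _ FE) (nH _ Un) => p [Up hE] fE Uh.
  rewrite -fE -hE (la_mul AUV) // ?hE //.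
    by congr (la_map A U V _ _); rewrite /gp /Gmul /= !mulr1 addr0 add0r.
  by rewrite /gp /Gmul /= !mulr1 addr0 add0r.
have HF : \forall p \near (0 : CC R * CC R), la_map A U V (gp a a) (graph p) =
    graph (H1 (F1 p, F2 p), H2 (F1 p, F2 p)).
  have nF := @near_pair R F1 F2 _ (n0 _ F1d) (n0 _ F2d) F10 F20.
  apply: filterS3 (filterI Un FE) (nF _ HE) (nF _ Un) => p [Up fE] hE Uf.
  rewrite -hE -fE (la_mul AUV) // ?fE //.
    by congr (la_map A U V _ _); rewrite /gp /Gmul /= !mulr1 addr0 add0r.
  by rewrite /gp /Gmul /= !mulr1 addr0 add0r.
have : a * a = 0.
  apply: (no_commuting_shears cF1 dF2 cH1 dH2 Fs Hs).
  by apply: filterS2 FH HF => p -> [].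
by move/eqP; rewrite mulf_eq0 orbb (negbTE a0).
Qed.
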